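(* Let $S$ be a set of four points chosen independently and uniformly at random from the unit square $[0,1]\times[0,1]$. Join every pair of points of $S$ with a straight line segment (an edge). Color each such edge red if it has positive slope and blue otherwise. Then the probability that $S$ defines a pair of crossing edges of the same color is equal to $1/4$.
   Context: Two edges cross if they intersect in their interiors. With the coloring convention used, horizontal edges (slope $0$) and vertical edges (undefined slope) are blue. *)

(* Defs.v *)
From HB Require Import structures.
From mathcomp Require Import all_boot all_order all_algebra.
From mathcomp Require Import all_classical all_reals all_analysis.

Set Implicit Arguments.
Unset Strict Implicit.
Unset Printing Implicit Defensive.

Import Order.TTheory GRing.Theory Num.Theory.

Local Open Scope classical_set_scope.
Local Open Scope ring_scope.

Section Probability.
Context {d d' : measure_display} {T : measurableType d} {T' : measurableType d'}
  {R : realType} (P : probability T R).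

Definition mutually_independent (I : finType) (X : I -> {RV P >-> T'}) : Prop :=
  forall (J : {set I}) (A : I -> set T'), (forall i, measurable (A i)) ->
    P (\bigcap_(i in [set` J]) (X i @^-1` A i)) =
    (\prod_(i in J) P (X i @^-1` A i))%E.

End Probability.

(* The plane with its Borel sigma-algebra; [measurableTypeR R] is [R]. *)
Notation plane R := (measurableTypeR R * measurableTypeR R)%type.

Section Plane.
Context {R : realType}.
Implicit Types p q : plane R.

Definition unit_square : set (plane R) := `[0, 1] `*` `[0, 1].

(* No normalising factor is needed, as the square has area 1. *)
Definition uniform_on_unit_square {d : measure_display} {T : measurableType d}
    (P : probability T R) (X : {RV P >-> plane R}) : Prop :=
  forall A : set (plane R), measurable A ->
    distribution P X A =
    (@lebesgue_measure R \x @lebesgue_measure R)%E (A `&` unit_square).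

(* An edge is represented by an ordered pair of its endpoints. *)
Definition is_edge (S : set (plane R)) (e : plane R * plane R) : Prop :=
  [/\ S e.1, S e.2 & e.1 <> e.2].

Definition same_edge (e f : plane R * plane R) : Prop :=
  [set e.1; e.2] = [set f.1; f.2].

Definition edge_interior (e : plane R * plane R) : set (plane R) :=
  [set (line_path e.1.1 e.2.1 t, line_path e.1.2 e.2.2 t) | t in `]0, 1[].

Definition edges_cross (e f : plane R * plane R) : Prop :=
  ~ same_edge e f /\ edge_interior e `&` edge_interior f !=set0.

Definition slope p q : R := (q.2 - p.2) / (q.1 - p.1).

Inductive color := Red | Blue.

(* The first conjunct makes the slope defined, so vertical edges are blue. *)
Definition edge_color (e : plane R * plane R) : color :=
  if (e.1.1 != e.2.1) && (0 < slope e.1 e.2) then Red else Blue.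

Definition has_monochromatic_crossing (S : set (plane R)) : Prop :=
  exists e f : plane R * plane R,
    [/\ is_edge S e, is_edge S f, edges_cross e f & edge_color e = edge_color f].

End Plane.

(* Main.v *)
(* The 8 coordinates are independent and uniform, so their law is invariant under
   permutations and under z_i |-> c - z_i, where c may depend on the other
   coordinates.  In particular, reflecting a coordinate between its two
   neighbours exchanges two consecutive gaps of sorted coordinates.

   Number the points by abscissa, at the cost of a factor 4!.  A red crossing
   forces the two leftmost points to be the two lowest ones, so that the ranks of
   the ordinates are 1234, 1243, 2134 or 2143; conversely, for these ranks there
   is a red crossing as soon as the points are in convex position.
   - 2143: they always are.
   - 1243: they are unless the second point is inside the triangle of the others;
     being below it and being above it both have probability 1/3.
   - 2134: the same, after reversing the order of the gaps.
   - 1234: compare the slopes of the three gap vectors with each other and with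
     the slope of their sum.  The points are in convex position if and only if the
     second vector has the median slope or is alone on its side of the total
     slope; by exchangeability both events have probability 1/3.
   Each order of the ordinates has probability 1/24, so a red crossing has
   probability (1 + 3 * 2/3)/24 = 1/8, and so has a blue one by the symmetry
   y |-> 1 - y. *)

Require Import Defs.
From HB Require Import structures.
From mathcomp Require Import all_boot all_order all_algebra fingroup perm.
From mathcomp Require Import all_classical all_reals all_analysis.
From mathcomp Require Import measurable_realfun ring lra zify.

Set Implicit Arguments.
Unset Strict Implicit.
Unset Printing Implicit Defensive.

Import Order.TTheory GRing.Theory Num.Theory.

Local Open Scope classical_set_scope.
Local Open Scope ring_scope.

(** * Uniform law on a cube: symmetries, Fubini in one coordinate, null sets *)

Lemma lebesgue_measure_reflect {R : realType} (c : R)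
    (A : set (measurableTypeR R)) : measurable A ->
  lebesgue_measure [set t : R | A (c - t)] = lebesgue_measure A.
Proof.
move=> mA; have mc : measurable_fun setT
    (fun t : measurableTypeR R => c - t : measurableTypeR R).
  exact: measurable_funB.
rewrite -/(pushforward lebesgue_measure
  (fun t : measurableTypeR R => c - t : measurableTypeR R) A).
apply/esym/lebesgue_measure_unique => //= _ [[a b]] _ <-.
(* The reflection turns []a, b]] into [[c - b, c - a[]: the closed end changes sides, the length
   stays. *)
rewrite /pushforward (_ : _ @^-1` _ = `[c - b, c - a[%classic); last first.
  by apply/seteqP; split => t; rewrite /= !in_itv/= => /andP[? ?]; apply/andP; split; lra.
rewrite !lebesgue_measure_itv/= !lte_fin ltrD2l ltrN2; case: ifP => // _.
by congr EFin; ring.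
Qed.

Section CoordinateSpace.
Context {I : finType} {R : realType}.
Implicit Types (A : I -> set (measurableTypeR R)) (i j : I) (t : R).

Definition box A : set (I -> measurableTypeR R) :=
  [set z | forall i, A i (z i)].

Definition boxes : set (set (I -> measurableTypeR R)) :=
  [set box A | A in [set A | forall i, measurable (A i)]].

Definition coords := g_sigma_algebraType boxes.

Implicit Types (z : coords) (B : set coords).

Lemma measurable_box A : (forall i, measurable (A i)) ->
  measurable (box A : set coords).
Proof. by move=> mA; apply: sub_sigma_algebra; exists A. Qed.

Lemma setI_closed_boxes : setI_closed boxes.
Proof.
move=> _ _ [A mA <-] [B mB <-]; exists (fun i => A i `&` B i).
  by move=> i; exact: measurableI.
apply/seteqP; split => z /=.
  by move=> AB; split => i; case: (AB i).
by move=> [zA zB] i; split; [exact: zA|exact: zB].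
Qed.

Lemma boxT : box (fun=> setT) = setT.
Proof. by apply/seteqP; split. Qed.

(** The boxes form a pi-system that generates the sigma-algebra and contains the whole space, on
    which [m1] is finite. Laws are thus compared on boxes only. *)
Lemma coords_measure_unique (m1 : probability coords R)
    (m2 : {measure set coords -> \bar R}) :
  (forall A, (forall i, measurable (A i)) -> m1 (box A) = m2 (box A)) ->
  forall B, measurable B -> m1 B = m2 B.
Proof.
move=> m12 B mB.
have bT : boxes setT by exists (fun=> setT) => //; exact: boxT.
apply: (@measure_unique _ R coords boxes (fun=> setT)) => //.
- exact: setI_closed_boxes.
- by rewrite bigcup_const//; exists 0%N.
- by move=> _ [A mA <-]; exact: m12.
- by move=> _; exact: le_lt_trans (probability_le1 m1 measurableT) (ltry _).
Qed.

Lemma measurable_fun_coords d (T : measurableType d) (f : T -> coords) :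
  (forall i, measurable_fun setT (fun x => f x i : measurableTypeR R)) ->
  measurable_fun setT f.
Proof.
move=> mf; apply: (@measurability _ _ T coords setT f boxes) => // _ [_ [A mA <-] <-].
rewrite setTI (_ : f @^-1` _ = \bigcap_i ((fun x => f x i) @^-1` A i)).
  apply: fin_bigcap_measurable => // i _.
  by rewrite -[X in measurable X]setTI; exact: mf.
by apply/seteqP; split => x /= => [fA i _|fA i]; exact: fA.
Qed.

Lemma measurable_coord i :
  measurable_fun setT (fun z : coords => z i : measurableTypeR R).
Proof.
move=> _ Y mY; rewrite setTI.
rewrite (_ : _ @^-1` Y = box (fun j => if j == i then Y else setT)).
  by apply: measurable_box => j; case: eqP.
apply/seteqP; split => z /= => [zY j|/(_ i)].
  by case: eqP => // ->.
by rewrite eqxx.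
Qed.

Definition upd z i t : coords := fun j => if j == i then t else z j.

Lemma measurable_upd i :
  measurable_fun setT (fun p : measurableTypeR R * coords => upd p.2 i p.1).
Proof.
apply: measurable_fun_coords => j; rewrite /upd; case: eqP => _.
  exact: measurable_fst.
exact: (measurableT_comp (measurable_coord j) measurable_snd).
Qed.

Lemma updd z i t : upd z i t i = t.
Proof. by rewrite /upd eqxx. Qed.

Lemma updu z i t u : upd (upd z i t) i u = upd z i u.
Proof. by apply/funext => j; rewrite /upd; case: eqP. Qed.

Definition relabel (g : I -> I) z : coords := fun i => z (g i).

(** By [coords_measure_unique] this pins down the law of independent coordinates, each uniform on
    [[0, 1]]. *)
Definition uniform_cube (Q : set coords -> \bar R) : Prop :=
  forall A, (forall i, measurable (A i)) ->
    Q (box A) = (\prod_i lebesgue_measure (A i `&` `[0%R, 1%R]))%E.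

Context (Q : probability coords R) (Qcube : uniform_cube Q).

Lemma cube_itv : lebesgue_measure (setT `&` `[0%R, 1%R] : set (measurableTypeR R)) = 1%E.
Proof. by rewrite setTI lebesgue_measure_itv/= lte_fin ltr01 oppr0 adde0. Qed.

Lemma measurable_relabel (g : I -> I) : measurable_fun setT (relabel g).
Proof. by apply: measurable_fun_coords => i; exact: measurable_coord. Qed.

(** An injective self-map of a finite type is a bijection, so it merely permutes the sides of a box
    and the factors of the product. *)
Lemma uniform_cube_relabel (g : I -> I) B : injective g -> measurable B ->
  Q (relabel g @^-1` B) = Q B.
Proof.
move=> injg mB; have mg := measurable_relabel g.
rewrite -/(pushforward Q (relabel g) B).
apply/esym; apply: coords_measure_unique => // A mA.
rewrite [LHS]Qcube//= /pushforward.
pose h := invF injg.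
have -> : relabel g @^-1` box A = box (A \o h).
  apply/seteqP; split => z /= zA i; first by have := zA (h i); rewrite /relabel f_invF.
  by have := zA (g i); rewrite /= /h invF_f.
rewrite Qcube => [|i]; last exact: mA.
rewrite [RHS](reindex g) /=; last by exists h => i _; rewrite /h (invF_f, f_invF).
by apply: eq_bigr => i _; rewrite /= /h invF_f.
Qed.

(** Fubini in one direction: overwriting coordinate [i] by an independent uniform value keeps the
    law, as is seen on boxes. *)
Lemma uniform_cube_section i B : measurable B ->
  Q B = (\int[Q]_z lebesgue_measure (`[0%R, 1%R] `&` [set t | B (upd z i t)]))%E.
Proof.
move=> mB; set L := @lebesgue_measure R.
pose D : set (measurableTypeR R * coords) := `[0%R, 1%R] `*` setT.
have mD : measurable D by apply: measurableX => //; exact: measurable_itv.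
have mi := @measurable_upd i.
pose m := mrestr (L \x^ Q)%E mD.
(* By definition [\x^] integrates over the second factor the measure of the sections, which is the
   right-hand side. *)
transitivity (pushforward m (fun p => upd p.2 i p.1) B); last first.
  rewrite /pushforward/= /m /mrestr/=.
  apply: eq_integral => z _; congr (L _); rewrite /ysection.
  apply/seteqP; split=> t /=; first by move=> /set_mem[? []].
  by move=> [? ?]; apply/mem_set.
apply: coords_measure_unique => // A mA; rewrite Qcube//= /m /mrestr /pushforward.
(* The old value of coordinate [i] is overwritten, hence unconstrained. *)
pose A' j := if j == i then setT else A j.
rewrite (_ : _ `&` D = (A i `&` `[0,1]) `*` box A'); last first.
  rewrite /A' /D; apply/seteqP; split => -[t z] /=.
    move=> [zA [t01 _]]; split.
      by split => //; have := zA i; rewrite updd.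
    by move=> j /=; case: eqP => // /eqP ji; have := zA j; rewrite /upd (negbTE ji).
  move=> [[tA t01] zA]; split => // j; rewrite /upd; case: eqP => [->//|/eqP ji].
  by have := zA j; rewrite /= (negbTE ji).
have mA' j : measurable (A' j) by rewrite /A'; case: eqP.
transitivity (L (A i `&` `[0%R, 1%R]) * Q (box A'))%E; last first.
  apply/esym; apply: product_measure2E; last exact: measurable_box.
  by apply: measurableI => //; exact: measurable_itv.
have A'i : A' i = setT by rewrite /A' eqxx.
rewrite Qcube// (bigD1 i)//= [in RHS](bigD1 i)//= A'i cube_itv mul1e.
by congr (_ * _)%E; apply: eq_bigr => j ji; rewrite /A' (negbTE ji).
Qed.

Lemma measurable_upd_section i B z : measurable B ->
  measurable [set t : measurableTypeR R | B (upd z i t)].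
Proof.
move=> mB; have := @measurable_upd i measurableT _ mB; rewrite setTI.
move=> /(measurable_ysection z); congr (measurable _).
by apply/seteqP; split => t; rewrite /ysection/= inE.
Qed.

Definition flip (c : pred I) z : coords := fun i => if c i then 1 - z i else z i.

Lemma measurable_flip (c : pred I) : measurable_fun setT (flip c).
Proof.
apply: measurable_fun_coords => i; rewrite /flip; case: (c i).
  by apply: (@measurable_funB _ _ R) => //; exact: measurable_coord.
exact: measurable_coord.
Qed.

Lemma uniform_cube_flip (c : pred I) B : measurable B ->
  Q (flip c @^-1` B) = Q B.
Proof.
move=> mB; have mf := measurable_flip c.
rewrite -/(pushforward Q (flip c) B).
apply/esym; apply: coords_measure_unique => // A mA.
rewrite [LHS]Qcube//= /pushforward.
pose A' i : set (measurableTypeR R) := if c i then [set t | A i (1 - t)] else A i.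
have mA' i : measurable (A' i).
  rewrite /A'; case: (c i) => //.
  have mc : measurable_fun setT
      (fun t : measurableTypeR R => 1 - t : measurableTypeR R).
    exact: measurable_funB.
  by have := mc measurableT _ (mA i); rewrite setTI.
have -> : flip c @^-1` box A = box A'.
  by apply/seteqP; split => z /= zA i; have := zA i; rewrite /flip /A'; case: (c i).
rewrite Qcube//; apply: eq_bigr => i _; rewrite /A'; case: (c i) => //.
rewrite -[LHS](@lebesgue_measure_reflect _ 1); last first.
  by apply: measurableI => //; exact: measurable_itv.
congr (lebesgue_measure _); apply/seteqP; split => t /=; rewrite !in_itv/=;
  by move=> [? /andP[? ?]]; split=> //; apply/andP; split; lra.
Qed.

(* Both sets have sections in direction [i] that are mirror images of each
   other, the centre depending on the other coordinates only. *)
Lemma uniform_cube_reflect i (c : coords -> R) (A B : set coords) :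
  measurable A -> measurable B ->
  (forall z t, c (upd z i t) = c z) ->
  (forall z, A z -> 0 <= z i <= 1) -> (forall z, B z -> 0 <= z i <= 1) ->
  (forall z, A z <-> B (upd z i (c z - z i))) ->
  Q A = Q B.
Proof.
move=> mA mB ci A01 B01 AB.
rewrite (uniform_cube_section i mA) (uniform_cube_section i mB).
apply: eq_integral => z _.
have s01 (D : set coords) : (forall z, D z -> 0 <= z i <= 1) ->
    `[0%R, 1%R] `&` [set t | D (upd z i t)] = [set t | D (upd z i t)].
  move=> D01; apply/seteqP; split => t /=; first by case.
  by move=> Dt; split => //; have := D01 _ Dt; rewrite updd in_itv.
rewrite !s01//.
rewrite -[RHS](@lebesgue_measure_reflect _ (c z)); last exact: measurable_upd_section.
congr (lebesgue_measure _); apply/seteqP; split => t /=.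
  by move=> /AB; rewrite updu updd ci.
by move=> Bt; apply/AB; rewrite updu updd ci.
Qed.

(** Each line in direction [i] meets [B] in at most one point, so every section is Lebesgue null. *)
Lemma uniform_cube_null i B : measurable B ->
  (forall z t u, B (upd z i t) -> B (upd z i u) -> t = u) -> Q B = 0%E.
Proof.
move=> mB Bi; rewrite (uniform_cube_section i mB).
apply: integral0_eq => z _.
apply/eqP; rewrite eq_le measure_ge0 andbT.
have [[t Bt]|nB] := pselect (exists t, B (upd z i t)).
  rewrite -(lebesgue_measure_set1 t); apply: le_measure; rewrite ?inE//.
  - apply: measurableI; [exact: measurable_itv|exact: measurable_upd_section].
  - by move=> u /= [_ Bu]; exact: Bi Bu Bt.
rewrite (_ : _ `&` _ = set0) ?measure0//.
by apply/seteqP; split => t //= [_ Bt]; apply: nB; exists t.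
Qed.

Lemma uniform_cube_itvoo : Q (box (fun=> `]0%R, 1%R[%classic)) = 1%E.
Proof.
rewrite Qcube => [|i]; last exact: measurable_itv.
apply: big1 => i _; rewrite setIidl; last exact: subset_itv_oo_cc.
by rewrite lebesgue_measure_itv/= lte_fin ltr01 oppr0 adde0.
Qed.

End CoordinateSpace.
Arguments coords : clear implicits.

(** * Equality up to null sets, and measurability of polynomial conditions *)

Lemma measure_eq_outside_null d (T : measurableType d) (R : realType)
    (mu : {measure set T -> \bar R}) (A B N : set T) :
  measurable A -> measurable B -> measurable N -> mu N = 0%E ->
  (forall z, ~ N z -> A z <-> B z) -> mu A = mu B.
Proof.
move=> mA mB mN N0 AB.
have N0' : (mu N <= 0)%E by rewrite N0.
have le (D E : set T) : measurable D -> measurable E ->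
    (forall z, ~ N z -> D z -> E z) -> (mu D <= mu E)%E.
  move=> mD mE DE; apply: (@le_trans _ _ (mu (E `|` N))).
    apply: le_measure; rewrite ?inE//; first exact: measurableU.
    by move=> z Dz; have [Nz|Nz] := pselect (N z); [right|left; exact: DE].
  by apply: (le_trans (measureU2 _ mE mN)); rewrite -[leRHS]adde0; exact: leeD.
by apply/eqP; rewrite eq_le !le// => z /AB H /H.
Qed.

Lemma measurable_bool d (T : measurableType d) (b : T -> bool) :
  measurable_fun setT b -> measurable [set x | b x].
Proof. by move=> mb; have := mb measurableT [set true] I; rewrite setTI. Qed.

Local Notation i0 := (@Ordinal 4 0 isT).
Local Notation i1 := (@Ordinal 4 1 isT).
Local Notation i2 := (@Ordinal 4 2 isT).
Local Notation i3 := (@Ordinal 4 3 isT).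

Section MeasurableRealFun.
Context {d : measure_display} {T : measurableType d} {R : realType}.
Implicit Types f g : T -> R.

Lemma measurable_fun_add f g : measurable_fun setT f -> measurable_fun setT g ->
  measurable_fun setT (fun z => f z + g z).
Proof. exact: measurable_funD. Qed.

Lemma measurable_fun_mul f g : measurable_fun setT f -> measurable_fun setT g ->
  measurable_fun setT (fun z => f z * g z).
Proof. exact: measurable_funM. Qed.

Lemma measurable_fun_opp f : measurable_fun setT f ->
  measurable_fun setT (fun z => - f z).
Proof. exact: measurable_funN. Qed.

Lemma measurable_fun_lt f g : measurable_fun setT f -> measurable_fun setT g ->
  measurable_fun setT (fun z => f z < g z).
Proof. exact: measurable_fun_ltr. Qed.

Lemma measurable_fun_eq f g : measurable_fun setT f -> measurable_fun setT g ->
  measurable_fun setT (fun z => f z == g z).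
Proof. exact: measurable_fun_eqr. Qed.

End MeasurableRealFun.

(* [true] indexes the abscissas and [false] the ordinates of four points. *)
Definition px {R : realType} (z : coords (bool * 'I_4)%type R) i : R :=
  z (true, i).
Definition py {R : realType} (z : coords (bool * 'I_4)%type R) i : R :=
  z (false, i).

Lemma measurable_px {R : realType} i :
  measurable_fun setT (fun z : coords _ R => px z i).
Proof. exact: (measurable_coord (true, i)). Qed.

Lemma measurable_py {R : realType} i :
  measurable_fun setT (fun z : coords _ R => py z i).
Proof. exact: (measurable_coord (false, i)). Qed.

(** Structural recursion on the formula; other atoms are closed by hypotheses, so abstract functions
    are accepted as well as coordinates. *)
Ltac measfun := lazymatch goal with
  | |- measurable_fun _ ?F =>
    lazymatch eval cbv beta in F with
    | fun z => @?f z && @?g z => apply: (@measurable_and _ _ _ f g); measfun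
    | fun z => @?f z || @?g z => apply: (@measurable_or _ _ _ f g); measfun
    | fun z => ~~ @?f z => apply: (@measurable_neg _ _ _ f); measfun
    | fun z => @?f z < @?g z => apply: (@measurable_fun_lt _ _ _ f g); measfun
    | fun z => @?f z == @?g z => apply: (@measurable_fun_eq _ _ _ f g); measfun
    | fun z => @?f z + @?g z => apply: (@measurable_fun_add _ _ _ f g); measfun
    | fun z => - @?f z => apply: (@measurable_fun_opp _ _ _ f); measfun
    | fun z => @?f z * @?g z => apply: (@measurable_fun_mul _ _ _ f g); measfun
    | fun z => px z ?i => exact: measurable_px
    | fun z => py z ?i => exact: measurable_py
    | fun z => ?c => first [assumption | exact: measurable_cst]
    | _ => try assumption
    end end.
Ltac meas := apply: measurable_bool; measfun.

(** The twelve introductions are the six functions and their six measurability hypotheses in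
    [gap_measurable]. *)
Ltac meas_gap := intros ? ? ? ? ? ? ? ? ? ? ? ?; measfun.
Ltac coordE := rewrite /px /py /upd /=.

(** * Events on the gaps of sorted coordinates, and exchangeability of the gaps *)

Section GapEvents.
Context {R : realType}.
Notation Z := (coords (bool * 'I_4)%type R).
Implicit Types z : Z.

Definition chain (u : 'I_4 -> R) : bool :=
  [&& 0 < u i0, u i0 < u i1, u i1 < u i2, u i2 < u i3 & u i3 < 1].

(** One of the [4! ^ 2] joint orders of abscissas and ordinates. The bounds [0] and [1] in [chain]
    keep the coordinates in [[0, 1]], as [uniform_cube_reflect] requires. *)
Definition cell z : bool := chain (px z) && chain (py z).

Lemma measurable_cell : measurable_fun setT cell.
Proof. by rewrite /cell /chain; measfun. Qed.

(* The first three arguments of [F] are the gaps between consecutive abscissas,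
   the last three those between consecutive ordinates. *)
Definition gap_event (F : R -> R -> R -> R -> R -> R -> bool) : set Z :=
  [set z | cell z &&
    F (px z i1 - px z i0) (px z i2 - px z i1) (px z i3 - px z i2)
      (py z i1 - py z i0) (py z i2 - py z i1) (py z i3 - py z i2)].

(** Quantifying over arbitrary measurable arguments makes the property stable under permutations of
    the gaps. *)
Definition gap_measurable (F : R -> R -> R -> R -> R -> R -> bool) : Prop :=
  forall f1 f2 f3 f4 f5 f6 : Z -> R,
    measurable_fun setT f1 -> measurable_fun setT f2 ->
    measurable_fun setT f3 -> measurable_fun setT f4 ->
    measurable_fun setT f5 -> measurable_fun setT f6 ->
    measurable_fun setT (fun z => F (f1 z) (f2 z) (f3 z) (f4 z) (f5 z) (f6 z)).

Lemma measurable_gap_event F : gap_measurable F -> measurable (gap_event F).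
Proof.
move=> mF; apply: measurable_bool; apply: measurable_and.
  exact: measurable_cell.
by apply: mF; measfun.
Qed.

Context (Q : probability Z R) (Qcube : uniform_cube Q).

Lemma cell_bounds z i : cell z -> 0 <= z i <= 1.
Proof.
case: i => b i /andP[/and5P[h1 h2 h3 h4 h5] /and5P[h6 h7 h8 h9 h10]].
have E (j : 'I_4) : [|| j == i0, j == i1, j == i2 | j == i3].
  by case: j => [[|[|[|[|]]]]].
rewrite /px /py in h1 h2 h3 h4 h5 h6 h7 h8 h9 h10.
by case: b; case/or4P: (E i) => /eqP ->; apply/andP; split; lra.
Qed.

Lemma reflect_gap (p q r : R) :
  (p + r - q - p = r - q) * (r - (p + r - q) = q - p).
Proof. by split; ring. Qed.

Lemma reflect_lt (p q r : R) :
  ((p < p + r - q) = (q < r)) * ((p + r - q < r) = (p < q)).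
Proof. by split; apply/idP/idP; lra. Qed.

(** The second abscissa is reflected between its neighbours. The next three lemmas do the same with
    another coordinate. *)
Lemma swap_x12 (F G : R -> R -> R -> R -> R -> R -> bool) :
  gap_measurable F -> gap_measurable G ->
  (forall a b c u v w, F a b c u v w = G b a c u v w) ->
  Q (gap_event F) = Q (gap_event G).
Proof.
move=> mF mG FG.
apply: (uniform_cube_reflect Qcube (i := (true, i1))
  (c := fun z => px z i0 + px z i2)) => //.
- exact: measurable_gap_event.
- exact: measurable_gap_event.
- by move=> z /andP[/cell_bounds].
- by move=> z /andP[/cell_bounds].
move=> z; rewrite /gap_event /cell /chain; coordE.
(* The reflection exchanges the two inequalities around the moved coordinate; [andbCA] aligns their
   order. *)
by rewrite FG !reflect_gap !reflect_lt (andbCA (_ < z (true, i1))).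
Qed.

Lemma swap_x23 (F G : R -> R -> R -> R -> R -> R -> bool) :
  gap_measurable F -> gap_measurable G ->
  (forall a b c u v w, F a b c u v w = G a c b u v w) ->
  Q (gap_event F) = Q (gap_event G).
Proof.
move=> mF mG FG.
apply: (uniform_cube_reflect Qcube (i := (true, i2))
  (c := fun z => px z i1 + px z i3)) => //.
- exact: measurable_gap_event.
- exact: measurable_gap_event.
- by move=> z /andP[/cell_bounds].
- by move=> z /andP[/cell_bounds].
move=> z; rewrite /gap_event /cell /chain; coordE.
by rewrite FG !reflect_gap !reflect_lt (andbCA (_ < z (true, i2))).
Qed.

Lemma swap_y12 (F G : R -> R -> R -> R -> R -> R -> bool) :
  gap_measurable F -> gap_measurable G ->
  (forall a b c u v w, F a b c u v w = G a b c v u w) ->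
  Q (gap_event F) = Q (gap_event G).
Proof.
move=> mF mG FG.
apply: (uniform_cube_reflect Qcube (i := (false, i1))
  (c := fun z => py z i0 + py z i2)) => //.
- exact: measurable_gap_event.
- exact: measurable_gap_event.
- by move=> z /andP[/cell_bounds].
- by move=> z /andP[/cell_bounds].
move=> z; rewrite /gap_event /cell /chain; coordE.
by rewrite FG !reflect_gap !reflect_lt (andbCA (_ < z (false, i1))).
Qed.

Lemma swap_y23 (F G : R -> R -> R -> R -> R -> R -> bool) :
  gap_measurable F -> gap_measurable G ->
  (forall a b c u v w, F a b c u v w = G a b c u w v) ->
  Q (gap_event F) = Q (gap_event G).
Proof.
move=> mF mG FG.
apply: (uniform_cube_reflect Qcube (i := (false, i2))
  (c := fun z => py z i1 + py z i3)) => //.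
- exact: measurable_gap_event.
- exact: measurable_gap_event.
- by move=> z /andP[/cell_bounds].
- by move=> z /andP[/cell_bounds].
move=> z; rewrite /gap_event /cell /chain; coordE.
by rewrite FG !reflect_gap !reflect_lt (andbCA (_ < z (false, i2))).
Qed.

(** Reflection in the diagonal is a relabelling of the coordinates. *)
Lemma swap_xy (F G : R -> R -> R -> R -> R -> R -> bool) :
  gap_measurable F -> gap_measurable G ->
  (forall a b c u v w, F a b c u v w = G u v w a b c) ->
  Q (gap_event F) = Q (gap_event G).
Proof.
move=> mF mG FG.
pose g (p : bool * 'I_4) := (~~ p.1, p.2).
rewrite -(uniform_cube_relabel Qcube (g := g)); last exact: measurable_gap_event.
  congr (Q _); apply/seteqP; split => z; rewrite /gap_event /cell /chain; coordE;
    by rewrite FG [X in X && _]andbC.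
by move=> [b i] [c j] [/negb_inj -> ->].
Qed.

(** Real-valued, so that [ring] and [lra] apply to probabilities. *)
Definition prob (A : set Z) : R := fine (Q A).

Lemma probE A : measurable A -> Q A = (prob A)%:E.
Proof. by move=> mA; rewrite fineK// fin_num_measure. Qed.

Lemma prob_split (A B D N : set Z) :
  measurable A -> measurable B -> measurable D -> measurable N -> Q N = 0%E ->
  (forall z, ~ N z -> D z <-> A z \/ B z) -> (forall z, A z -> ~ B z) ->
  prob D = prob A + prob B.
Proof.
move=> mA mB mD mN N0 DAB AB.
rewrite /prob (measure_eq_outside_null (B := A `|` B) mD _ mN N0)//; last first.
  exact: measurableU.
rewrite measureU ?fineD ?fin_num_measure//.
by apply/seteqP; split => z // [] /AB.
Qed.

Lemma prob_split3 (A B E D N : set Z) :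
  measurable A -> measurable B -> measurable E -> measurable D ->
  measurable N -> Q N = 0%E ->
  (forall z, ~ N z -> D z <-> [\/ A z, B z | E z]) ->
  (forall z, A z -> ~ B z) -> (forall z, A z -> ~ E z) ->
  (forall z, B z -> ~ E z) ->
  prob D = prob A + prob B + prob E.
Proof.
move=> mA mB mE mD mN N0 DE AB AE BE.
rewrite (@prob_split (A `|` B) E D N)//; last 3 first.
- exact: measurableU.
- by move=> z /DE ->; split=> [[]|[[]|]]; [left; left|left; right|right|
    constructor 1|constructor 2|constructor 3].
- by move=> z [/AE|/BE].
congr (_ + _); apply: (@prob_split _ _ _ set0) => //; first exact: measurableU.
Qed.

(** Along direction [i], [f] is affine with slope [g], nonzero on the cell, so it vanishes there at
    most once. *)
Lemma null_affine i (f g : Z -> R) :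
  measurable_fun setT f ->
  (forall z t, g (upd z i t) = g z) ->
  (forall z, cell z -> g z != 0) ->
  (forall z t, f (upd z i t) = f (upd z i 0) + t * g z) ->
  let N := [set z | cell z && (f z == 0)] in measurable N /\ Q N = 0%E.
Proof.
move=> mf gi gn0 fE N.
have mN : measurable N.
  apply: measurable_bool; apply: measurable_and; first exact: measurable_cell.
  by apply: measurable_fun_eq.
split=> //; apply: (uniform_cube_null Qcube (i := i)) => // z t u.
rewrite /N /= fE (fE z u) => /andP[/gn0 g0 /eqP ft] /andP[_ /eqP fu].
by rewrite gi in g0; apply: (mulIf g0) => /=; lra.
Qed.

Lemma nullU (N M : set Z) : measurable N /\ Q N = 0%E ->
  measurable M /\ Q M = 0%E -> measurable (N `|` M) /\ Q (N `|` M) = 0%E.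
Proof.
move=> [mN N0] [mM M0]; split; first exact: measurableU.
by apply: null_set_setU.
Qed.

(* If the ordinates of the points, listed by abscissa, have ranks 1, 2, 4, 3,
   then the second point is below the line through the first and the fourth. *)
Definition below_first (a b c u v w : R) : bool := u * (a + b + c) < (u + v) * a.

(* [u / (u + v)] is uniform given the rest.  The points [a / s] and [(a + b) / s],
   where [s = a + b + c], cut [0, 1] into three intervals, and [u / (u + v)] is
   as likely to be in any of them since the gaps [a], [b], [c] are exchangeable.
   *)
Lemma prob_below_first :
  prob [set z | cell z] = 3 * prob (gap_event below_first).
Proof.
(* In [M1], [M2], [M3] the ratio [u / (u + v)] lies in the first, second, third interval cut out by
   [a / s] and [(a + b) / s]; in [K2], [K3] it is below [b / s], [c / s]. *)
pose M1 := gap_event below_first.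
pose M2 := gap_event (fun a b c u v w =>
  ((u + v) * a < u * (a + b + c)) && (u * (a + b + c) < (u + v) * (a + b))).
pose M3 := gap_event (fun a b c u v w => (u + v) * (a + b) < u * (a + b + c)).
pose K2 := gap_event (fun a b c u v w => u * (a + b + c) < (u + v) * b).
pose K3 := gap_event (fun a b c u v w => u * (a + b + c) < (u + v) * c).
have mC := measurable_bool measurable_cell.
have gB : gap_measurable below_first by rewrite /below_first; meas_gap.
have mM1 : measurable M1 by apply: measurable_gap_event.
have mM2 : measurable M2 by apply: measurable_gap_event; meas_gap.
have mM3 : measurable M3 by apply: measurable_gap_event; meas_gap.
have mK2 : measurable K2 by apply: measurable_gap_event; meas_gap.
have mK3 : measurable K3 by apply: measurable_gap_event; meas_gap.
have Q12 : Q M1 = Q K2.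
  apply: swap_x12 => [||a b c u v w]; [exact: gB|by meas_gap|].
  by rewrite /below_first (addrC a b).
have Q23 : Q K2 = Q K3.
  apply: swap_x23 => [||a b c u v w]; [by meas_gap|by meas_gap|].
  by rewrite addrAC.
(* Exchanging [u] and [v] replaces the ratio by its complement to 1, and
   [1 - c / s = (a + b) / s]. *)
have Q3 : Q K3 = Q M3.
  apply: swap_y12 => [||a b c u v w]; [by meas_gap|by meas_gap|].
  by rewrite -subr_gt0 -[RHS]subr_gt0; congr (0 < _); ring.
(* The centre is chosen so that the ratio [t = u / (u + v)] becomes [(a + b) / s - t], which
   exchanges []0, b / s[] and []a / s, (a + b) / s[]. *)
have Q2 : Q K2 = Q M2.
  apply: (uniform_cube_reflect Qcube (i := (false, i1))
    (c := fun z => 2 * py z i0 +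
      (py z i2 - py z i0) * (px z i2 - px z i0) / (px z i3 - px z i0))) => //.
  - by move=> z /andP[/cell_bounds].
  - by move=> z /andP[/cell_bounds].
  move=> z; rewrite /K2 /M2 /gap_event /cell /chain; coordE.
  set p0 := z (true, i0); set p1 := z (true, i1).
  set p2 := z (true, i2); set p3 := z (true, i3).
  set q0 := z (false, i0); set q1 := z (false, i1).
  set q2 := z (false, i2); set q3 := z (false, i3).
  case: (boolP [&& 0 < p0, p0 < p1, p1 < p2, p2 < p3 & p3 < 1]) =>
    [/and5P[h0 h1 h2 h3 h4]|_]; last by split.
  rewrite /=.
  have s0 : 0 < p3 - p0 by lra.
  set r := _ / _; have rE : r * (p3 - p0) = (q2 - q0) * (p2 - p0).
    by rewrite /r mulfVK// gt_eqF.
  clearbody r.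
  have -> : p1 - p0 + (p2 - p1) + (p3 - p2) = p3 - p0 by ring.
  have -> : q1 - q0 + (q2 - q1) = q2 - q0 by ring.
  have -> : p1 - p0 + (p2 - p1) = p2 - p0 by ring.
  have -> : 2 * q0 + r - q1 - q0 + (q2 - (2 * q0 + r - q1)) = q2 - q0 by ring.
  have -> : (2 * q0 + r - q1 - q0) * (p3 - p0) =
    (q2 - q0) * (p2 - p0) - (q1 - q0) * (p3 - p0) by rewrite -rE; ring.
  split=> /andP[/and5P[g0 g1 g2 g3 g4]].
    move=> H; have H1 : 0 < (q1 - q0) * (p3 - p0) by apply: mulr_gt0; lra.
    have H2 : 0 < (q2 - q0) * (p3 - p2) by apply: mulr_gt0; lra.
    have H3 : 0 < (q2 - q0) * (p1 - p0) by apply: mulr_gt0; lra.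
    have K1 : q0 < 2 * q0 + r - q1.
      by rewrite -(ltr_pM2r s0); nra.
    have K4 : 2 * q0 + r - q1 < q2.
      by rewrite -(ltr_pM2r s0); nra.
    rewrite g0 K1 K4 g3 g4 /=; apply/andP; split; nra.
  move=> /andP[H H'].
  have q02 : q0 < q2 by lra.
  have H2 : 0 < (q2 - q0) * (p3 - p2) by apply: mulr_gt0; lra.
  have H3 : 0 < (q2 - q0) * (p1 - p0) by apply: mulr_gt0; lra.
  have K1 : q0 < q1 by rewrite -subr_gt0 -(pmulr_lgt0 _ s0); nra.
  have K4 : q1 < q2 by rewrite -subr_gt0 -(pmulr_lgt0 _ s0); nra.
  rewrite g0 K1 K4 g3 g4 /=; nra.
pose a z := px z i1 - px z i0; pose b z := px z i2 - px z i1.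
pose c z := px z i3 - px z i2; pose u z := py z i1 - py z i0.
pose v z := py z i2 - py z i1.
(* The two boundary cases are null: [u + v] does not involve the second ordinate, so both
   expressions are affine in it with slope [s]. *)
have nA : let N := [set z | cell z &&
    (u z * (a z + b z + c z) - (u z + v z) * a z == 0)] in
    measurable N /\ Q N = 0%E.
  apply: (null_affine (i := (false, i1)) (g := fun z => px z i3 - px z i0)) => //.
  - by rewrite /a /b /c /u /v; measfun.
  - by move=> z /andP[/and5P[h0 h1 h2 h3 h4] _]; rewrite subr_eq0 gt_eqF//; lra.
  - by move=> z t; rewrite /a /b /c /u /v; coordE; ring.
have nB : let N := [set z | cell z &&
    (u z * (a z + b z + c z) - (u z + v z) * (a z + b z) == 0)] in
    measurable N /\ Q N = 0%E.
  apply: (null_affine (i := (false, i1)) (g := fun z => px z i3 - px z i0)) => //.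
  - by rewrite /a /b /c /u /v; measfun.
  - by move=> z /andP[/and5P[h0 h1 h2 h3 h4] _]; rewrite subr_eq0 gt_eqF//; lra.
  - by move=> z t; rewrite /a /b /c /u /v; coordE; ring.
have [mN N0] := nullU nA nB.
have lt z : cell z -> (u z + v z) * a z < (u z + v z) * (a z + b z).
  move=> /andP[/and5P[_ h1 h2 h3 _] /and5P[_ k1 k2 _ _]].
  by rewrite ltr_pM2l /u /v /a /b; lra.
have eM1 z : M1 z = cell z && (u z * (a z + b z + c z) < (u z + v z) * a z) by [].
have eM2 z : M2 z = cell z &&
  ((u z + v z) * a z < u z * (a z + b z + c z) < (u z + v z) * (a z + b z)) by [].
have eM3 z : M3 z = cell z &&
  ((u z + v z) * (a z + b z) < u z * (a z + b z + c z)) by [].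
rewrite (prob_split3 mM1 mM2 mM3 mC mN N0).
- by rewrite /prob -Q3 -Q23 -Q2 -Q12; ring.
- move=> z nN; rewrite eM1 eM2 eM3; split=> /= [cz|]; last by case=> /andP[].
  move: nN; rewrite /= cz /= !subr_eq0 => /not_orP[/negP nU /negP nV].
  move: nU nV; case: ltrgtP => // UA _; first by constructor 1.
  by case: ltrgtP => // UV _; [constructor 2|constructor 3].
- move=> z; rewrite eM1 eM2 => /andP[cz h] /andP[_ /andP[h' _]].
  by have := lt_trans h h'; rewrite ltxx.
- move=> z; rewrite eM1 eM3 => /andP[cz h] /andP[_ h'].
  by have := lt_trans h (lt_trans (lt z cz) h'); rewrite ltxx.
- move=> z; rewrite eM2 eM3 => /andP[cz /andP[_ h]] /andP[_ h'].
  by have := lt_trans h h'; rewrite ltxx.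
Qed.
End GapEvents.

(** * Signed areas and sign conditions for convex position *)

Definition orient3 {R : realType} (x y : 'I_4 -> R) i j k : R :=
  (x j - x i) * (y k - y i) - (x k - x i) * (y j - y i).

(* For points numbered by increasing abscissa: 03 crosses 12, or 02 crosses 13. *)
Definition convex_pos {R : realType} (x y : 'I_4 -> R) : bool :=
  ((orient3 x y i0 i1 i3 * orient3 x y i0 i2 i3 < 0) &&
   (orient3 x y i0 i1 i2 * orient3 x y i1 i2 i3 < 0)) ||
  ((0 < orient3 x y i0 i1 i2 * orient3 x y i0 i2 i3) &&
   (0 < orient3 x y i0 i1 i3 * orient3 x y i1 i2 i3)).

Section Signs.
Context {R : realType}.
Implicit Types a b c u v w p q r x y t : R.

(* For the same ranks 1, 2, 4, 3: the second point is above the line through the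
   first and the third. *)
Definition left_first a b c u v w : bool := a * (u + v + w) < (a + b) * u.

(* The slopes of the second and third gap vectors [(b, v)] and [(c, w)] are on
   the same side of the slope of their sum with [(a, u)]. *)
Definition odd_first a b c u v w : bool :=
  0 < (b * (u + v + w) - (a + b + c) * v) * (c * (u + v + w) - (a + b + c) * w).

(* The slope of [(a, u)] is between those of [(b, v)] and [(c, w)]. *)
Definition mid_first a b c u v w : bool :=
  0 < (b * u - a * v) * (a * w - c * u).

Lemma mulr_gt0_signs p q : p != 0 -> q != 0 -> (0 < p * q) = ((0 < p) == (0 < q)).
Proof.
move=> p0 q0; have [pp|np|pE] := ltgtP 0 p; last by rewrite -pE eqxx in p0.
  by rewrite pmulr_rgt0//; case: (0 < q).
rewrite nmulr_rgt0//; have [pq|nq|qE] := ltgtP 0 q => //.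
by rewrite -qE eqxx in q0.
Qed.

Lemma oppr_gt0_sign p : p != 0 -> (0 < - p) = ~~ (0 < p).
Proof. by move=> p0; rewrite oppr_gt0 -leNgt lt_neqAle p0. Qed.

(** The signs of [x], [y], [t] compare three slopes: first with second, second with third, first
    with third. The equation makes the comparison transitive, so exactly one slope is the median
    when none are equal. *)
Lemma one_of_three_mid a b c x y t : 0 < a -> 0 < b -> 0 < c ->
  b * t = a * y + c * x ->
  [/\ x != 0 -> y != 0 -> t != 0 -> [|| 0 < - x * t, 0 < x * y | 0 < t * - y],
    ~~ ((0 < - x * t) && (0 < x * y)), ~~ ((0 < - x * t) && (0 < t * - y)) &
    ~~ ((0 < x * y) && (0 < t * - y))].
Proof.
move=> a0 b0 c0 tE.
have [->|x0] := eqVneq x 0; first by rewrite !(oppr0, mul0r, ltxx).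
have [->|y0] := eqVneq y 0; first by rewrite !(oppr0, mulr0, ltxx, andbF).
have [->|t0] := eqVneq t 0; first by rewrite !(mul0r, mulr0, ltxx, andbF).
rewrite !mulr_gt0_signs ?oppr_eq0// !oppr_gt0_sign//.
have H1 : (0 < x) && (0 < y) ==> (0 < t).
  by apply/implyP => /andP[xp yp]; rewrite -(pmulr_rgt0 _ b0) tE addr_gt0// mulr_gt0.
have H2 : ~~ (0 < x) && ~~ (0 < y) ==> ~~ (0 < t).
  apply/implyP; rewrite -!leNgt => /andP[xp yp]; rewrite -(pmulr_rle0 _ b0) tE.
  by rewrite -oppr_ge0 opprD addr_ge0// -mulrN mulr_ge0 ?oppr_ge0// ltW.
by move: H1 H2; case: (0 < x); case: (0 < y); case: (0 < t).
Qed.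

Lemma mid_relation a b c u v w :
  b * (a * w - c * u) = a * (b * w - c * v) + c * (a * v - b * u).
Proof. by ring. Qed.

(** Three nonzero reals of sum 0 do not all have the same sign, so exactly one of them is alone with
    its sign. *)
Lemma one_of_three_odd x y t : x + y + t = 0 ->
  [/\ x != 0 -> y != 0 -> t != 0 -> [|| 0 < y * t, 0 < x * t | 0 < x * y],
    ~~ ((0 < y * t) && (0 < x * t)), ~~ ((0 < y * t) && (0 < x * y)) &
    ~~ ((0 < x * t) && (0 < x * y))].
Proof.
move=> E.
have [->|x0] := eqVneq x 0; first by rewrite !(mul0r, ltxx, andbF).
have [->|y0] := eqVneq y 0; first by rewrite !(mul0r, mulr0, ltxx, andbF).
have [->|t0] := eqVneq t 0; first by rewrite !(mulr0, ltxx, andbF).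
rewrite !mulr_gt0_signs//.
have H1 : ~~ [&& 0 < x, 0 < y & 0 < t] by apply/negP => /and3P[*]; lra.
have H2 : [|| 0 < x, 0 < y | 0 < t].
  rewrite !ltNge -!negb_and; apply/negP => /and3P[*].
  have : x = 0 by lra.
  by move/eqP; rewrite (negbTE x0).
by move: H1 H2; case: (0 < x); case: (0 < y); case: (0 < t).
Qed.

(** If the first slope is between the other two, so is the slope of the sum, which therefore
    separates them. *)
Lemma mid_first_not_odd a b c u v w : 0 < a -> 0 < b -> 0 < c ->
  mid_first a b c u v w -> ~~ odd_first a b c u v w.
Proof.
move=> a0 b0 c0; rewrite /mid_first /odd_first.
have -> : b * (u + v + w) - (a + b + c) * v =
  (b * u - a * v) + (b * w - c * v) by ring.
have -> : c * (u + v + w) - (a + b + c) * w =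
  - ((a * w - c * u) + (b * w - c * v)) by ring.
have E : a * (b * w - c * v) = b * (a * w - c * u) + c * (b * u - a * v) by ring.
move: (b * u - a * v) (a * w - c * u) (b * w - c * v) E => x t y E.
rewrite mulrN oppr_gt0 -leNgt.
have [t0|t0|->] := ltgtP t 0; last by rewrite mulr0 ltxx.
  rewrite nmulr_lgt0// => x0.
  have y0 : y < 0.
    by rewrite -(pmulr_rlt0 _ a0) E; rewrite -[ltRHS]addr0 ltrD// pmulr_rlt0.
  by rewrite -mulrNN mulr_ge0//; lra.
rewrite pmulr_lgt0// => x0.
have y0 : 0 < y by rewrite -(pmulr_rgt0 _ a0) E addr_gt0// mulr_gt0.
by rewrite mulr_ge0//; lra.
Qed.

Lemma same_sign_lt p q : p < q ->
  ((0 < p) && (0 < q)) || ((q < 0) && (p < 0)) = (0 < p) || (q < 0).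
Proof.
move=> pq; congr (_ || _).
  by case: (ltP 0 p) => // p0; rewrite (lt_trans p0 pq).
by case: (ltP q 0) => // q0; rewrite (lt_trans pq q0).
Qed.

(** When [x] and [y] have the same sign, [t] shares it, so the second alternative of [convex_pos]
    holds. When their signs differ, that alternative would force [t] to be both positive and
    negative. When one of them is 0, both sides are false. *)
Lemma convex_pos_signs a b c x y t : 0 < a -> 0 < b -> 0 < c ->
  b * t = a * y + c * x ->
  (((x + t) * (y + t) < 0) && (x * y < 0)) ||
  ((0 < x * (y + t)) && (0 < (x + t) * y)) =
  ((x + t) * (y + t) < 0) || (0 < x * y).
Proof.
move=> a0 b0 c0 tE.
have pos p q : 0 <= p -> 0 <= q -> 0 <= a * p + c * q.
  by move=> p0 q0; rewrite addr_ge0// mulr_ge0// ltW.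
have tpos : 0 <= x -> 0 <= y -> 0 <= t.
  by move=> x0 y0; rewrite -(pmulr_rge0 _ b0) tE pos.
have tneg : x <= 0 -> y <= 0 -> t <= 0.
  move=> x0 y0; rewrite -oppr_ge0 -(pmulr_rge0 _ b0) mulrN tE opprD -!mulrN.
  by rewrite pos ?oppr_ge0.
have [xy|xy|/eqP] := ltgtP (x * y) 0.
- rewrite andbT orbF; suff -> : (0 < x * (y + t)) && (0 < (x + t) * y) = false.
    by rewrite orbF.
  apply/negP => /andP[h1 h2]; move: xy; rewrite mulr_lt0 => /and3P[x0 y0].
  have [x_lt0 /= |x_ge0 /=] := ltP x 0.
    rewrite -leNgt => y_ge0.
    have y_gt0 : 0 < y by rewrite lt_neqAle eq_sym y0.
    by move: h1 h2; rewrite nmulr_rgt0// pmulr_lgt0// => h1 h2; lra.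
  move=> y_lt0; have x_gt0 : 0 < x by rewrite lt_neqAle eq_sym x0.
  by move: h1 h2; rewrite pmulr_rgt0// nmulr_lgt0// => h1 h2; lra.
- rewrite andbF orbT /=.
  have [x_lt0|x_gt0|x0] := ltgtP x 0; last by rewrite x0 mul0r ltxx in xy.
    have y_lt0 : y < 0 by move: xy; rewrite nmulr_rgt0.
    by rewrite nmulr_rgt0// nmulr_lgt0//; have := tneg (ltW x_lt0) (ltW y_lt0); lra.
  have y_gt0 : 0 < y by move: xy; rewrite pmulr_rgt0.
  by rewrite pmulr_rgt0// pmulr_lgt0//; have := tpos (ltW x_gt0) (ltW y_gt0); lra.
- rewrite andbF orbF /= mulf_eq0 => /orP[]/eqP z0; rewrite z0 in tpos tneg *.
    rewrite mul0r ltxx add0r /=; apply/esym/negbTE; rewrite -leNgt.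
    have [y0|/ltW y0] := leP 0 y.
      by have t0 := tpos (lexx _) y0; rewrite mulr_ge0// addr_ge0.
    have t0 := tneg (lexx _) y0; rewrite -mulrNN mulr_ge0// ?oppr_ge0//.
    by rewrite -[leRHS]addr0 lerD.
  rewrite mulr0 ltxx andbF add0r /=; apply/esym/negbTE; rewrite -leNgt.
  have [x0|/ltW x0] := leP 0 x.
    by have t0 := tpos x0 (lexx _); rewrite mulr_ge0// addr_ge0.
  have t0 := tneg x0 (lexx _); rewrite -mulrNN mulr_ge0// ?oppr_ge0//.
  by rewrite -[leRHS]addr0 lerD.
Qed.

End Signs.

(** * Convex position for the four relevant orders of the ordinates *)

Section Cells.
Context {R : realType}.
Implicit Types a b c u v w : R.
Variables (a b c u v w : R) (x y : 'I_4 -> R).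
Hypotheses (a0 : 0 < a) (b0 : 0 < b) (c0 : 0 < c).
Hypotheses (u0 : 0 < u) (v0 : 0 < v) (w0 : 0 < w).
Hypotheses (xa : x i1 - x i0 = a) (xb : x i2 - x i1 = b) (xc : x i3 - x i2 = c).

Let xab : x i2 - x i0 = a + b. Proof. by rewrite -xa -xb; ring. Qed.
Let xbc : x i3 - x i1 = b + c. Proof. by rewrite -xc -xb; ring. Qed.
Let xabc : x i3 - x i0 = a + b + c. Proof. by rewrite -xc -xb -xa; ring. Qed.

Let dE := (xa, xb, xc, xab, xbc, xabc).

(* The digits are the ranks of the ordinates of the points. *)
Lemma convex_pos_2143 : y i0 - y i1 = u -> y i3 - y i0 = v -> y i2 - y i3 = w ->
  convex_pos x y.
Proof.
move=> yu yv yw; rewrite /convex_pos /orient3 !dE.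
have -> : y i3 - y i0 = v by [].
have -> : y i1 - y i0 = - u by rewrite -yu; ring.
have -> : y i2 - y i0 = v + w by rewrite -yv -yw; ring.
have -> : y i2 - y i1 = u + v + w by rewrite -yv -yw -yu; ring.
have -> : y i3 - y i1 = u + v by rewrite -yv -yu; ring.
apply/orP; left; apply/andP; split.
  rewrite pmulr_rlt0; last by rewrite mulrN opprK addr_gt0// mulr_gt0// !addr_gt0.
  rewrite subr_lt0 -subr_gt0.
  by have -> : (a + b + c) * (v + w) - (a + b) * v = (a + b) * w + c * (v + w);
    [ring|rewrite addr_gt0 // mulr_gt0 ?addr_gt0].
rewrite pmulr_rlt0; last by rewrite mulrN opprK addr_gt0// mulr_gt0// !addr_gt0.
rewrite subr_lt0 -subr_gt0.
by have -> : (b + c) * (u + v + w) - b * (u + v) = b * w + c * (u + v + w);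
  [ring|rewrite addr_gt0 // mulr_gt0 ?addr_gt0].
Qed.

(** The triangles 023 and 123 are always clockwise, so only the signs of 013 and 012 matter. Since
    the former orientation is smaller, they agree iff 013 is positive or 012 is negative. *)
Lemma convex_pos_1243 : y i1 - y i0 = u -> y i3 - y i1 = v -> y i2 - y i3 = w ->
  convex_pos x y = below_first a b c u v w || left_first a b c u v w.
Proof.
move=> yu yv yw; rewrite /convex_pos /orient3 !dE /below_first /left_first.
have -> : y i3 - y i0 = u + v by rewrite -yu -yv; ring.
have -> : y i1 - y i0 = u by [].
have -> : y i2 - y i0 = u + v + w by rewrite -yv -yw -yu; ring.
have -> : y i2 - y i1 = v + w by rewrite -yv -yw; ring.
have -> : y i3 - y i1 = v by [].
have n023 : (a + b) * (u + v) - (a + b + c) * (u + v + w) < 0.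
  rewrite -oppr_gt0.
  have -> : - ((a + b) * (u + v) - (a + b + c) * (u + v + w)) =
    (a + b) * w + c * (u + v + w) by ring.
  by rewrite addr_gt0// mulr_gt0// !addr_gt0.
have n123 : b * v - (b + c) * (v + w) < 0.
  rewrite -oppr_gt0.
  have -> : - (b * v - (b + c) * (v + w)) = b * w + c * (v + w) by ring.
  by rewrite addr_gt0// mulr_gt0// !addr_gt0.
rewrite !(nmulr_llt0 _ n023) !(nmulr_lgt0 _ n023).
rewrite !(nmulr_llt0 _ n123) !(nmulr_lgt0 _ n123).
rewrite same_sign_lt; last first.
  rewrite -subr_gt0.
  have -> : a * (u + v + w) - (a + b) * u - (a * (u + v) - (a + b + c) * u) =
    a * w + c * u by ring.
  by rewrite addr_gt0// mulr_gt0.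
by rewrite subr_gt0 subr_lt0 mulrC [a * _]mulrC.
Qed.

(** A half turn leads to the order 1243 with all gaps read backwards. Here 012 and 013 are the
    triangles of constant orientation. *)
Lemma convex_pos_2134 : y i0 - y i1 = u -> y i2 - y i0 = v -> y i3 - y i2 = w ->
  convex_pos x y = below_first c b a w v u || left_first c b a w v u.
Proof.
move=> yu yv yw; rewrite /convex_pos /orient3 !dE /below_first /left_first.
have -> : y i3 - y i0 = v + w by rewrite -yw -yv; ring.
have -> : y i1 - y i0 = - u by rewrite -yu; ring.
have -> : y i2 - y i0 = v by [].
have -> : y i2 - y i1 = u + v by rewrite -yv -yu; ring.
have -> : y i3 - y i1 = u + v + w by rewrite -yv -yu -yw; ring.
have p012 : 0 < a * v - (a + b) * - u.
  by rewrite mulrN opprK addr_gt0// mulr_gt0// addr_gt0.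
have p013 : 0 < a * (v + w) - (a + b + c) * - u.
  by rewrite mulrN opprK addr_gt0// mulr_gt0// !addr_gt0.
rewrite !(pmulr_rlt0 _ p012) !(pmulr_rgt0 _ p012).
rewrite !(pmulr_rlt0 _ p013) !(pmulr_rgt0 _ p013).
rewrite orbC [X in X || _]andbC same_sign_lt; last first.
  rewrite -subr_gt0.
  have -> : (a + b) * (v + w) - (a + b + c) * v -
    (b * (u + v + w) - (b + c) * (u + v)) = a * w + c * u by ring.
  by rewrite addr_gt0// mulr_gt0.
rewrite orbC; congr (_ || _).
  by rewrite -[RHS]subr_gt0 -oppr_gt0; congr (0 < _); ring.
by rewrite -[RHS]subr_gt0; congr (0 < _); ring.
Qed.

Lemma convex_pos_1234 : y i1 - y i0 = u -> y i2 - y i1 = v -> y i3 - y i2 = w ->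
  convex_pos x y = odd_first b a c v u w || mid_first b a c v u w.
Proof.
move=> yu yv yw; rewrite /convex_pos /orient3 !dE /odd_first /mid_first.
have -> : y i3 - y i0 = u + v + w by rewrite -yw -yv -yu; ring.
have -> : y i2 - y i0 = u + v by rewrite -yv -yu; ring.
have -> : y i3 - y i1 = v + w by rewrite -yv -yw; ring.
rewrite yu yv.
have -> : a * (u + v) - (a + b) * u = a * v - b * u by ring.
have -> : b * (v + w) - (b + c) * v = b * w - c * v by ring.
(* These are the cross products of pairs of gap vectors; the orientations of 012, 123, 013, 023 are
   [x1], [x2], [x1 + x3], [x2 + x3]. *)
pose x1 := a * v - b * u; pose x2 := b * w - c * v; pose x3 := a * w - c * u.
have -> : a * (u + v + w) - (a + b + c) * u = x1 + x3 by rewrite /x1 /x3; ring.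
have -> : (a + b) * (u + v + w) - (a + b + c) * (u + v) = x2 + x3.
  by rewrite /x2 /x3; ring.
have -> : a * (v + u + w) - (b + a + c) * u = x1 + x3 by rewrite /x1 /x3; ring.
have -> : c * (v + u + w) - (b + a + c) * w = - (x2 + x3) by rewrite /x2 /x3; ring.
have E : b * x3 = a * x2 + c * x1 by rewrite /x1 /x2 /x3; ring.
rewrite -/x1 -/x2.
by clearbody x1 x2 x3; rewrite mulrN oppr_gt0; apply: (convex_pos_signs a0 b0 c0).
Qed.

End Cells.

(** * Probability of convex position in each order *)

Section CellProbabilities.
Context {R : realType}.
Notation Z := (coords (bool * 'I_4)%type R).
Implicit Types (z : Z) (F : R -> R -> R -> R -> R -> R -> bool).
Context (Q : probability Z R) (Qcube : uniform_cube Q).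

Lemma gap_measurable_below_first : gap_measurable (@below_first R).
Proof. by rewrite /below_first; meas_gap. Qed.

Lemma gap_measurable_left_first : gap_measurable (@left_first R).
Proof. by rewrite /left_first; meas_gap. Qed.

Lemma gap_measurable_odd_first : gap_measurable (@odd_first R).
Proof. by rewrite /odd_first; meas_gap. Qed.

Lemma gap_measurable_mid_first : gap_measurable (@mid_first R).
Proof. by rewrite /mid_first; meas_gap. Qed.

Lemma gap_measurable_or F G : gap_measurable F -> gap_measurable G ->
  gap_measurable (fun a b c u v w => F a b c u v w || G a b c u v w).
Proof.
move=> mF mG f1 f2 f3 f4 f5 f6 *.
by apply: measurable_or; [apply: mF|apply: mG].
Qed.

Lemma prob_gap_swap12 F : gap_measurable F ->
  prob Q (gap_event (fun a b c u v w => F b a c v u w)) = prob Q (gap_event F).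
Proof.
move=> mF; rewrite /prob; congr fine; apply/esym.
transitivity (Q (gap_event (fun a b c u v w => F b a c u v w))).
  by apply: swap_x12 => // f1 f2 f3 f4 f5 f6 *; exact: mF.
by apply: swap_y12 => // f1 f2 f3 f4 f5 f6 *; exact: mF.
Qed.

(** A reversal is the product of the adjacent transpositions 12, 23, 12, applied to the abscissas
    and then to the ordinates. *)
Lemma prob_gap_rev F : gap_measurable F ->
  prob Q (gap_event (fun a b c u v w => F c b a w v u)) = prob Q (gap_event F).
Proof.
move=> mF; rewrite /prob; congr fine; apply/esym.
transitivity (Q (gap_event (fun a b c u v w => F b a c u v w))).
  by apply: swap_x12 => // f1 f2 f3 f4 f5 f6 *; exact: mF.
transitivity (Q (gap_event (fun a b c u v w => F c a b u v w))).
  by apply: swap_x23 => // f1 f2 f3 f4 f5 f6 *; exact: mF.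
transitivity (Q (gap_event (fun a b c u v w => F c b a u v w))).
  by apply: swap_x12 => // f1 f2 f3 f4 f5 f6 *; exact: mF.
transitivity (Q (gap_event (fun a b c u v w => F c b a v u w))).
  by apply: swap_y12 => // f1 f2 f3 f4 f5 f6 *; exact: mF.
transitivity (Q (gap_event (fun a b c u v w => F c b a w u v))).
  by apply: swap_y23 => // f1 f2 f3 f4 f5 f6 *; exact: mF.
by apply: swap_y12 => // f1 f2 f3 f4 f5 f6 *; exact: mF.
Qed.

Lemma cell_gaps z : cell z ->
  ((0 < px z i1 - px z i0) * (0 < px z i2 - px z i1) * (0 < px z i3 - px z i2)) *
  ((0 < py z i1 - py z i0) * (0 < py z i2 - py z i1) * (0 < py z i3 - py z i2)).
Proof.
move=> /andP[/and5P[_ h1 h2 h3 _] /and5P[_ k1 k2 k3 _]].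
by rewrite !subr_gt0; do !split.
Qed.

Lemma prob_cell_1243 : 3 * prob Q (gap_event (fun a b c u v w =>
  below_first a b c u v w || left_first a b c u v w)) = 2 * prob Q [set z | cell z].
Proof.
have mB := @gap_measurable_below_first; have mL := @gap_measurable_left_first.
(* [left_first] is [below_first] with the axes exchanged. *)
have BL : prob Q (gap_event (@left_first R)) = prob Q (gap_event (@below_first R)).
  by rewrite /prob; congr fine; apply: swap_xy.
rewrite (@prob_split _ _ (gap_event (@below_first R))
  (gap_event (@left_first R)) _ set0)//.
- by rewrite BL (prob_below_first Qcube); ring.
- exact: measurable_gap_event.
- exact: measurable_gap_event.
- by apply: measurable_gap_event; apply: gap_measurable_or.
- move=> z _; rewrite /gap_event /=; split.
    by move=> /andP[-> /orP[]->]; [left|right].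
  by case=> /andP[-> ->]; rewrite ?orbT.
- move=> z /andP[/cell_gaps [[[a0 b0] c0] [[u0 v0] w0]]].
  rewrite /gap_event /= /below_first /left_first => h1 /andP[_ h2].
  move: a0 b0 c0 u0 v0 w0 h1 h2.
  set a := px z i1 - _; set b := px z i2 - _; set c := px z i3 - _.
  set u := py z i1 - _; set v := py z i2 - _; set w := py z i3 - _.
  move=> a0 b0 c0 u0 v0 w0 h1 h2.
  (* Adding [h1] and [h2] leaves [c * u + a * w < 0]. *)
  have c1 : 0 < c * u by rewrite mulr_gt0.
  have c2 : 0 < a * w by rewrite mulr_gt0.
  by clear -h1 h2 c1 c2; nra.
Qed.

Lemma prob_cell_2134 : 3 * prob Q (gap_event (fun a b c u v w =>
  below_first c b a w v u || left_first c b a w v u)) = 2 * prob Q [set z | cell z].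
Proof.
rewrite -prob_cell_1243; congr (_ * _).
rewrite (prob_gap_rev (F := fun a b c u v w =>
  below_first a b c u v w || left_first a b c u v w))//.
by apply: gap_measurable_or;
  [exact: gap_measurable_below_first|exact: gap_measurable_left_first].
Qed.

Let a z := px z i1 - px z i0.
Let b z := px z i2 - px z i1.
Let c z := px z i3 - px z i2.
Let u z := py z i1 - py z i0.
Let v z := py z i2 - py z i1.
Let w z := py z i3 - py z i2.

Let null_gap i (f g : Z -> R) := @null_affine _ _ Qcube i f g.

Ltac gaps := rewrite /a /b /c /u /v /w.

(** The cross products [d1], [d2], [d3] of the gap vectors with their sum add up to 0. Off a null
    set exactly one vector is alone on its side, and the three cases are equally likely by
    exchangeability. *)
Lemma prob_odd_first : 3 * prob Q (gap_event (@odd_first R)) = prob Q [set z | cell z].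
Proof.
have mO := @gap_measurable_odd_first.
pose F2 a b c u v w : bool := @odd_first R b a c v u w.
pose F3 a b c u v w : bool := @odd_first R c b a w v u.
have p2 : prob Q (gap_event F2) = prob Q (gap_event (@odd_first R))
  by exact: prob_gap_swap12.
have p3 : prob Q (gap_event F3) = prob Q (gap_event (@odd_first R))
  by exact: prob_gap_rev.
pose d1 z := a z * (u z + v z + w z) - (a z + b z + c z) * u z.
pose d2 z := b z * (u z + v z + w z) - (a z + b z + c z) * v z.
pose d3 z := c z * (u z + v z + w z) - (a z + b z + c z) * w z.
have n1 : let N := [set z | cell z && (d1 z == 0)] in measurable N /\ Q N = 0%E.
  apply: (null_gap (i := (false, i1)) (g := fun z => - (px z i3 - px z i0))) => //.
  - by rewrite /d1; gaps; measfun.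
  - move=> z /cell_gaps [[[h1 h2] h3] _]; rewrite oppr_eq0 gt_eqF//; lra.
  - by move=> z t; rewrite /d1; gaps; coordE; ring.
have n2 : let N := [set z | cell z && (d2 z == 0)] in measurable N /\ Q N = 0%E.
  apply: (null_gap (i := (false, i1)) (g := fun z => px z i3 - px z i0)) => //.
  - by rewrite /d2; gaps; measfun.
  - move=> z /cell_gaps [[[h1 h2] h3] _]; rewrite gt_eqF//; lra.
  - by move=> z t; rewrite /d2; gaps; coordE; ring.
have n3 : let N := [set z | cell z && (d3 z == 0)] in measurable N /\ Q N = 0%E.
  apply: (null_gap (i := (false, i2)) (g := fun z => px z i3 - px z i0)) => //.
  - by rewrite /d3; gaps; measfun.
  - move=> z /cell_gaps [[[h1 h2] h3] _]; rewrite gt_eqF//; lra.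
  - by move=> z t; rewrite /d3; gaps; coordE; ring.
have [mN N0] := nullU n1 (nullU n2 n3).
have dsum z : d1 z + d2 z + d3 z = 0 by rewrite /d1 /d2 /d3; ring.
have E1 z : gap_event (@odd_first R) z = cell z && (0 < d2 z * d3 z) by [].
have E2 z : gap_event F2 z = cell z && (0 < d1 z * d3 z) :> Prop.
  rewrite /gap_event /= /F2 /odd_first -/(a z) -/(b z) -/(c z) -/(u z) -/(v z) -/(w z).
  by rewrite /d1 /d3 [v z + u z]addrC [b z + a z]addrC.
have E3 z : gap_event F3 z = cell z && (0 < d1 z * d2 z) :> Prop.
  rewrite /gap_event /= /F3 /odd_first -/(a z) -/(b z) -/(c z) -/(u z) -/(v z) -/(w z).
  rewrite /d1 /d2; congr (is_true (_ && (_ < _))); ring.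
have H z : ~ ([set z | cell z && (d1 z == 0)] `|`
    ([set z | cell z && (d2 z == 0)] `|` [set z | cell z && (d3 z == 0)])) z ->
    cell z -> [/\ d1 z != 0, d2 z != 0 & d3 z != 0].
  by move=> + cz; rewrite /= cz /= => /not_orP[/negP ? /not_orP[/negP ? /negP ?]].
have m1 := measurable_gap_event mO.
have m2 : measurable (gap_event F2).
  by apply: measurable_gap_event => f1 f2 f3 f4 f5 f6 *; exact: mO.
have m3 : measurable (gap_event F3).
  by apply: measurable_gap_event => f1 f2 f3 f4 f5 f6 *; exact: mO.
have mC := measurable_bool (@measurable_cell R).
rewrite (prob_split3 m1 m2 m3 mC mN N0).
- by rewrite p2 p3; ring.
- move=> z /[dup] nN /H{nN}nN; rewrite E1 E2 E3; split=> [cz|]; last by case=> /andP[].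
  have [x0 y0 t0] := nN cz.
  have [/(_ x0 y0 t0) O _ _ _] := one_of_three_odd (dsum z).
  move: cz; rewrite /= => cz; rewrite cz /=.
  by case/or3P: O => ->; [constructor 1|constructor 2|constructor 3].
- move=> z; rewrite E1 E2 => /andP[_ h1] /andP[_ h2].
  by have [_ + _ _] := one_of_three_odd (dsum z); rewrite h1 h2.
- move=> z; rewrite E1 E3 => /andP[_ h1] /andP[_ h2].
  by have [_ _ + _] := one_of_three_odd (dsum z); rewrite h1 h2.
- move=> z; rewrite E2 E3 => /andP[_ h1] /andP[_ h2].
  by have [_ _ _ +] := one_of_three_odd (dsum z); rewrite h1 h2.
Qed.

(** Off a null set exactly one of the three gap vectors has the median slope, and the three cases
    are equally likely. *)
Lemma prob_mid_first : 3 * prob Q (gap_event (@mid_first R)) = prob Q [set z | cell z].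
Proof.
have mO := @gap_measurable_mid_first.
pose F2 a b c u v w : bool := @mid_first R b a c v u w.
pose F3 a b c u v w : bool := @mid_first R c b a w v u.
have p2 : prob Q (gap_event F2) = prob Q (gap_event (@mid_first R))
  by exact: prob_gap_swap12.
have p3 : prob Q (gap_event F3) = prob Q (gap_event (@mid_first R))
  by exact: prob_gap_rev.
pose d1 z := a z * v z - b z * u z.
pose d2 z := b z * w z - c z * v z.
pose d3 z := a z * w z - c z * u z.
have n1 : let N := [set z | cell z && (d1 z == 0)] in measurable N /\ Q N = 0%E.
  apply: (null_gap (i := (false, i1)) (g := fun z => - (px z i2 - px z i0))) => //.
  - by rewrite /d1; gaps; measfun.
  - move=> z /cell_gaps [[[h1 h2] h3] _]; rewrite oppr_eq0 gt_eqF//; lra.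
  - by move=> z t; rewrite /d1; gaps; coordE; ring.
have n2 : let N := [set z | cell z && (d2 z == 0)] in measurable N /\ Q N = 0%E.
  apply: (null_gap (i := (false, i1)) (g := fun z => px z i3 - px z i2)) => //.
  - by rewrite /d2; gaps; measfun.
  - move=> z /cell_gaps [[[h1 h2] h3] _]; rewrite gt_eqF//; lra.
  - by move=> z t; rewrite /d2; gaps; coordE; ring.
have n3 : let N := [set z | cell z && (d3 z == 0)] in measurable N /\ Q N = 0%E.
  apply: (null_gap (i := (false, i1)) (g := fun z => - (px z i3 - px z i2))) => //.
  - by rewrite /d3; gaps; measfun.
  - move=> z /cell_gaps [[[h1 h2] h3] _]; rewrite oppr_eq0 gt_eqF//; lra.
  - by move=> z t; rewrite /d3; gaps; coordE; ring.
have [mN N0] := nullU n1 (nullU n2 n3).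
have E1 z : gap_event (@mid_first R) z = cell z && (0 < - d1 z * d3 z) :> Prop.
  rewrite /gap_event /= /mid_first -/(a z) -/(b z) -/(c z) -/(u z) -/(v z) -/(w z).
  by rewrite /d1 opprB.
have E2 z : gap_event F2 z = cell z && (0 < d1 z * d2 z) by [].
have E3 z : gap_event F3 z = cell z && (0 < d3 z * - d2 z) :> Prop.
  rewrite /gap_event /= /F3 /mid_first -/(a z) -/(b z) -/(c z) -/(u z) -/(v z) -/(w z).
  rewrite /d3 /d2; congr (is_true (_ && (_ < _))); ring.
have H z : ~ ([set z | cell z && (d1 z == 0)] `|`
    ([set z | cell z && (d2 z == 0)] `|` [set z | cell z && (d3 z == 0)])) z ->
    cell z -> [/\ d1 z != 0, d2 z != 0 & d3 z != 0].
  by move=> + cz; rewrite /= cz /= => /not_orP[/negP ? /not_orP[/negP ? /negP ?]].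
have m1 := measurable_gap_event mO.
have m2 : measurable (gap_event F2).
  by apply: measurable_gap_event => f1 f2 f3 f4 f5 f6 *; exact: mO.
have m3 : measurable (gap_event F3).
  by apply: measurable_gap_event => f1 f2 f3 f4 f5 f6 *; exact: mO.
have mC := measurable_bool (@measurable_cell R).
have O z : cell z -> _ := fun cz => let h := cell_gaps cz in
  one_of_three_mid h.1.1.1 h.1.1.2 h.1.2
    (mid_relation (a z) (b z) (c z) (u z) (v z) (w z)).
rewrite (prob_split3 m1 m2 m3 mC mN N0).
- by rewrite p2 p3; ring.
- move=> z /[dup] nN /H{nN}nN; rewrite E1 E2 E3; split=> [cz|]; last by case=> /andP[].
  have [x0 y0 t0] := nN cz.
  have [/(_ x0 y0 t0) + _ _ _] := O z cz.
  move: cz; rewrite /= => cz; rewrite cz /=.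
  by case/or3P => ->; [constructor 1|constructor 2|constructor 3].
- move=> z; rewrite E1 E2 => /andP[cz h1] /andP[_ h2].
  by have [_ + _ _] := O z cz; rewrite h1 h2.
- move=> z; rewrite E1 E3 => /andP[cz h1] /andP[_ h2].
  by have [_ _ + _] := O z cz; rewrite h1 h2.
- move=> z; rewrite E2 E3 => /andP[cz h1] /andP[_ h2].
  by have [_ _ _ +] := O z cz; rewrite h1 h2.
Qed.

Lemma prob_cell_1234 : 3 * prob Q (gap_event (fun a b c u v w =>
  odd_first b a c v u w || mid_first b a c v u w)) = 2 * prob Q [set z | cell z].
Proof.
have mO := @gap_measurable_odd_first; have mM := @gap_measurable_mid_first.
rewrite (prob_gap_swap12 (F := fun a b c u v w =>
  odd_first a b c u v w || mid_first a b c u v w)); last exact: gap_measurable_or.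
rewrite (@prob_split _ _ (gap_event (@odd_first R)) (gap_event (@mid_first R)) _ set0)//.
- by rewrite mulrDr prob_odd_first prob_mid_first; ring.
- exact: measurable_gap_event.
- exact: measurable_gap_event.
- by apply: measurable_gap_event; apply: gap_measurable_or.
- move=> z _; rewrite /gap_event /=; split.
    by move=> /andP[-> /orP[]->]; [left|right].
  by case=> /andP[-> ->]; rewrite ?orbT.
- move=> z /andP[/cell_gaps [[[a0 b0] c0] [[u0 v0] w0]]].
  move=> /[swap] /andP[_ /(mid_first_not_odd a0 b0 c0)].
  by move=> /negP.
Qed.

End CellProbabilities.

(** * Crossing of two edges as a polynomial condition *)

Section Crossing.
Context {R : realType}.
Implicit Types p q r s : plane R.

(** Twice the signed area of the triangle [pqr], positive for a left turn. *)
Definition orient p q r : R :=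
  (q.1 - p.1) * (r.2 - p.2) - (r.1 - p.1) * (q.2 - p.2).

Definition proper_cross p q r s : bool :=
  (orient r s p * orient r s q < 0) && (orient p q r * orient p q s < 0).

Definition parallel p q r s : bool :=
  (q.1 - p.1) * (s.2 - r.2) - (q.2 - p.2) * (s.1 - r.1) == 0.

(* position of [t] along the line from [r] to [s], scaled by [dot r s s] *)
Definition dot r s t : R :=
  (t.1 - r.1) * (s.1 - r.1) + (t.2 - r.2) * (s.2 - r.2).

(** Two edges on one line: some endpoint of [pq] comes before [s] and some endpoint comes after
    [r]. *)
Definition overlap p q r s : bool :=
  [&& parallel p q r s, orient r s p == 0,
    (dot r s p < dot r s s) || (dot r s q < dot r s s) &
    (0 < dot r s p) || (0 < dot r s q)].

Definition crossb p q r s : bool := proper_cross p q r s || overlap p q r s.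

Lemma dot_gt0 r s : r <> s -> 0 < dot r s s.
Proof.
move=> rs; rewrite /dot -!expr2 lt_neqAle addr_ge0 ?sqr_ge0// andbT eq_sym.
apply/negP; rewrite paddr_eq0 ?sqr_ge0// !sqrf_eq0 !subr_eq0 => /andP[/eqP h1 /eqP h2].
by apply: rs; case: r h1 h2 => ? ? /=; case: s => ? ? /= -> ->.
Qed.

Lemma itv_common (A B V : R) : A < B -> A < V -> 0 < B -> 0 < V ->
  exists m, [/\ 0 < m, m < V, A < m & m < B].
Proof.
move=> AB AV B0 V0.
exists ((Num.max A 0 + Num.min B V) / 2).
have h : Num.max A 0 < Num.min B V by rewrite gt_max !lt_min AB AV B0 V0.
have [h1 h2] : A <= Num.max A 0 /\ 0 <= Num.max A 0 by rewrite !le_max !lexx orbT.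
have [h3 h4] : Num.min B V <= B /\ Num.min B V <= V by rewrite !ge_min !lexx orbT.
by split; lra.
Qed.

(** Degenerate positions are included, so that the crossing event itself, and not just its generic
    part, is seen to be measurable. *)
Lemma interior_meetE p q r s : p <> q -> r <> s ->
  (edge_interior (p, q) `&` edge_interior (r, s) !=set0) <-> crossb p q r s.
Proof.
move=> pq rs.
have V0 := dot_gt0 rs; have U0 := dot_gt0 pq.
case: p q r s => p1 p2 [q1 q2] [r1 r2] [s1 s2] in pq rs V0 U0 *.
rewrite /crossb /proper_cross /overlap /parallel /orient /dot /= in V0 U0 *.
split.
  move=> [_ /= [[/= s0 s01 <-] [t0 t01]]].
  rewrite /line_path /= !in_itv /= in s01 t01 * => -[E1 E2].
  case/andP: s01 => s_gt0 s_lt1; case/andP: t01 => t_gt0 t_lt1.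
  (* Measured from the common point, all differences are combinations of [q - p] and [s - r], so
     each orientation is a multiple of their cross product [D]. *)
  have -> : p1 - r1 = t0 * (s1 - r1) - s0 * (q1 - p1) by lra.
  have -> : p2 - r2 = t0 * (s2 - r2) - s0 * (q2 - p2) by lra.
  have -> : q1 - r1 = t0 * (s1 - r1) + (1 - s0) * (q1 - p1) by lra.
  have -> : q2 - r2 = t0 * (s2 - r2) + (1 - s0) * (q2 - p2) by lra.
  have -> : r1 - p1 = s0 * (q1 - p1) - t0 * (s1 - r1) by lra.
  have -> : r2 - p2 = s0 * (q2 - p2) - t0 * (s2 - r2) by lra.
  have -> : s1 - p1 = s0 * (q1 - p1) + (1 - t0) * (s1 - r1) by lra.
  have -> : s2 - p2 = s0 * (q2 - p2) + (1 - t0) * (s2 - r2) by lra.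
  move: V0 U0; move: (q1 - p1) (q2 - p2) (s1 - r1) (s2 - r2) => u1 u2 v1 v2 V0 U0.
  set D := u1 * v2 - u2 * v1.
  have -> : v1 * (t0 * v2 - s0 * u2) - (t0 * v1 - s0 * u1) * v2 = s0 * D.
    by rewrite /D; ring.
  have -> : v1 * (t0 * v2 + (1 - s0) * u2) - (t0 * v1 + (1 - s0) * u1) * v2 =
    - ((1 - s0) * D) by rewrite /D; ring.
  have -> : u1 * (s0 * u2 - t0 * v2) - (s0 * u1 - t0 * v1) * u2 = - (t0 * D).
    by rewrite /D; ring.
  have -> : u1 * (s0 * u2 + (1 - t0) * v2) - (s0 * u1 + (1 - t0) * v1) * u2 =
    (1 - t0) * D by rewrite /D; ring.
  have [->|D0] := eqVneq D 0.
    apply/orP; right; rewrite mulr0 eqxx /=.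
    have -> : (t0 * v1 - s0 * u1) * v1 + (t0 * v2 - s0 * u2) * v2 =
      t0 * (v1 * v1 + v2 * v2) - s0 * (u1 * v1 + u2 * v2) by ring.
    have -> : (t0 * v1 + (1 - s0) * u1) * v1 + (t0 * v2 + (1 - s0) * u2) * v2 =
      t0 * (v1 * v1 + v2 * v2) + (1 - s0) * (u1 * v1 + u2 * v2) by ring.
    move: V0; move: (v1 * v1 + v2 * v2) (u1 * v1 + u2 * v2) => V k V0.
    have h1 : 0 < t0 * V by rewrite mulr_gt0.
    have h2 : t0 * V < V by rewrite gtr_pMl.
    have [k0|k0] := leP 0 k.
      have h3 : 0 <= s0 * k by rewrite mulr_ge0// ltW.
      have h4 : 0 <= (1 - s0) * k by rewrite mulr_ge0// subr_ge0 ltW.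
      by apply/andP; split; apply/orP; [left|right]; lra.
    have h3 : s0 * k < 0 by rewrite pmulr_rlt0.
    have h4 : (1 - s0) * k < 0 by rewrite pmulr_rlt0// subr_gt0.
    by apply/andP; split; apply/orP; [right|left]; lra.
  have D2 : 0 < D * D by rewrite -expr2 exprn_even_gt0.
  apply/orP; left; apply/andP; split.
    have -> : s0 * D * - ((1 - s0) * D) = - ((s0 * (1 - s0)) * (D * D)) by ring.
    by rewrite oppr_lt0 mulr_gt0// mulr_gt0// subr_gt0.
  have -> : - (t0 * D) * ((1 - t0) * D) = - ((t0 * (1 - t0)) * (D * D)) by ring.
  by rewrite oppr_lt0 mulr_gt0// mulr_gt0// subr_gt0.
move=> H.
suff [a [b [/andP a01 /andP b01 E1 E2]]] : exists a b, [/\ 0 < a < 1, 0 < b < 1,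
    p1 + a * (q1 - p1) = r1 + b * (s1 - r1) &
    p2 + a * (q2 - p2) = r2 + b * (s2 - r2)].
  exists (line_path p1 q1 a, line_path p2 q2 a); split.
    by exists a => //=; rewrite in_itv /=; apply/andP.
  exists b; first by rewrite /= in_itv /=; apply/andP.
  by rewrite /line_path /=; congr (_, _); lra.
(* An affine function with values [g] and [e] of opposite signs at the ends of an edge vanishes at
   the parameter [g / (g - e)]. *)
have ratio (g e : R) : g * e < 0 -> 0 < g / (g - e) < 1 /\ g - e != 0.
  move=> ge.
  have [g0|g0|g0] := ltgtP g 0; last by rewrite g0 mul0r ltxx in ge.
    have e0 : 0 < e by move: ge; rewrite nmulr_rlt0.
    have d0 : g - e < 0 by lra.
    split; last by rewrite lt_eqF.
    apply/andP; split; first by rewrite nmulr_rgt0 ?invr_lt0.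
    by rewrite ltr_ndivrMr// mul1r; lra.
  have e0 : e < 0 by move: ge; rewrite pmulr_rlt0.
  have d0 : 0 < g - e by lra.
  split; last by rewrite gt_eqF.
  by rewrite divr_gt0//= ltr_pdivrMr// mul1r; lra.
case/orP: H => [/andP[/ratio [h1 D0] /ratio [h2 D0']]|].
  do 2!eexists; split; [exact: h1|exact: h2| |].
    by field; rewrite D0 D0'.
  by field; rewrite D0 D0'.
case/and4P => /eqP D0 /eqP O0.
move: D0 O0 U0 V0.
have -> : q1 - r1 = (p1 - r1) + (q1 - p1) by ring.
have -> : q2 - r2 = (p2 - r2) + (q2 - p2) by ring.
suff : (q1 - p1) * (s2 - r2) - (q2 - p2) * (s1 - r1) = 0 ->
    (s1 - r1) * (p2 - r2) - (p1 - r1) * (s2 - r2) = 0 ->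
    0 < (q1 - p1) * (q1 - p1) + (q2 - p2) * (q2 - p2) ->
    0 < (s1 - r1) * (s1 - r1) + (s2 - r2) * (s2 - r2) ->
    ((p1 - r1) * (s1 - r1) + (p2 - r2) * (s2 - r2) <
       (s1 - r1) * (s1 - r1) + (s2 - r2) * (s2 - r2)) ||
    ((p1 - r1 + (q1 - p1)) * (s1 - r1) + (p2 - r2 + (q2 - p2)) * (s2 - r2) <
       (s1 - r1) * (s1 - r1) + (s2 - r2) * (s2 - r2)) ->
    (0 < (p1 - r1) * (s1 - r1) + (p2 - r2) * (s2 - r2)) ||
    (0 < (p1 - r1 + (q1 - p1)) * (s1 - r1) + (p2 - r2 + (q2 - p2)) * (s2 - r2)) ->
    exists a b, [/\ 0 < a < 1, 0 < b < 1,
      (p1 - r1) + a * (q1 - p1) = b * (s1 - r1) &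
      (p2 - r2) + a * (q2 - p2) = b * (s2 - r2)].
  move=> H D0 O0 U0 V0 h1 h2; have [a [b [ha hb E1 E2]]] := H D0 O0 U0 V0 h1 h2.
  by exists a, b; split=> //; lra.
move: (p1 - r1) (p2 - r2) (q1 - p1) (q2 - p2) (s1 - r1) (s2 - r2).
move=> w1 w2 u1 u2 v1 v2 D0 O0 U0 V0.
set A := w1 * v1 + w2 * v2; set V := v1 * v1 + v2 * v2.
have -> : (w1 + u1) * v1 + (w2 + u2) * v2 = A + (u1 * v1 + u2 * v2).
  by rewrite /A; ring.
set k := u1 * v1 + u2 * v2 => h1 h2.
(* Lagrange's identity: the squares of the dot and cross products add up to the product of the
   squared lengths, and the cross product is 0. *)
have k0 : k != 0.
  apply/eqP => k0; have := mulr_gt0 U0 V0.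
  have -> : (u1 * u1 + u2 * u2) * (v1 * v1 + v2 * v2) =
    k * k + (u1 * v2 - u2 * v1) * (u1 * v2 - u2 * v1) by rewrite /k; ring.
  by rewrite k0 D0 !mul0r addr0 ltxx.
(* On the scaled line the edges are []0, V[] and the interval between [A] and [A + k]; [m] is a
   common point. *)
have [m [m0 mV m01]] : exists m, [/\ 0 < m, m < V & 0 < (m - A) / k < 1].
  have [k_lt0|k_gt0|kE] := ltgtP k 0; last by rewrite kE eqxx in k0.
    have [| | | |m [? ? mA mB]] := @itv_common (A + k) A V; first by lra.
    - by case/orP: h1 => //; lra.
    - by case/orP: h2 => //; lra.
    - exact: V0.
    exists m; split=> //; apply/andP; split.
      by rewrite nmulr_lgt0 ?invr_lt0// subr_lt0.
    by rewrite ltr_ndivrMr// mul1r; lra.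
  have [| | | |m [? ? mA mB]] := @itv_common A (A + k) V; first by lra.
  - by case/orP: h1 => //; lra.
  - by case/orP: h2 => //; lra.
  - exact: V0.
  exists m; split=> //; apply/andP; split.
    by rewrite divr_gt0// subr_gt0.
  by rewrite ltr_pdivrMr// mul1r; lra.
have V0' : V != 0 by rewrite gt_eqF.
exists ((m - A) / k), (m / V); split=> //.
- by rewrite divr_gt0//= ltr_pdivrMr// mul1r.
(* As [w] and [u] are parallel to [v], they equal their projections on it. *)
- have e1 : w1 * V = A * v1.
    apply/eqP; rewrite -subr_eq0.
    have -> : w1 * V - A * v1 = - v2 * (v1 * w2 - w1 * v2) by rewrite /V /A /k; ring.
    by rewrite O0 mulr0.
  have e2 : u1 * V = k * v1.
    apply/eqP; rewrite -subr_eq0.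
    have -> : u1 * V - k * v1 = v2 * (u1 * v2 - u2 * v1) by rewrite /V /A /k; ring.
    by rewrite D0 mulr0.
  apply: (mulIf V0').
  have -> : (w1 + (m - A) / k * u1) * V = w1 * V + (m - A) / k * (u1 * V) by ring.
  by rewrite e1 e2 mulrA divfK// mulrAC divfK//; ring.
- have e1 : w2 * V = A * v2.
    apply/eqP; rewrite -subr_eq0.
    have -> : w2 * V - A * v2 = v1 * (v1 * w2 - w1 * v2) by rewrite /V /A /k; ring.
    by rewrite O0 mulr0.
  have e2 : u2 * V = k * v2.
    apply/eqP; rewrite -subr_eq0.
    have -> : u2 * V - k * v2 = - v1 * (u1 * v2 - u2 * v1) by rewrite /V /A /k; ring.
    by rewrite D0 mulr0.
  apply: (mulIf V0').
  have -> : (w2 + (m - A) / k * u2) * V = w2 * V + (m - A) / k * (u2 * V) by ring.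
  by rewrite e1 e2 mulrA divfK// mulrAC divfK//; ring.
Qed.

End Crossing.

(** * Monochromatic crossings among four points *)

Section Quadruples.
Context {R : realType}.
Implicit Types p q r s : plane R.

(** A product in place of the quotient: polynomial, symmetric in the endpoints, and 0 on vertical
    edges, which are thus not red. *)
Definition red p q : bool := 0 < (q.1 - p.1) * (q.2 - p.2).

(** Equality of points is spelled out on real coordinates to be within reach of [measfun]. *)
Definition monob p q r s : bool :=
  [&& (p.1 != q.1 :> R) || (p.2 != q.2 :> R),
    (r.1 != s.1 :> R) || (r.2 != s.2 :> R),
    ~~ ([&& p.1 == r.1 :> R, p.2 == r.2 :> R, q.1 == s.1 :> R & q.2 == s.2 :> R] ||
        [&& p.1 == s.1 :> R, p.2 == s.2 :> R, q.1 == r.1 :> R & q.2 == r.2 :> R]),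
    crossb p q r s &
    (red p q && red r s) || (~~ red p q && ~~ red r s)].

Lemma plane_neqP p q :
  reflect (p <> q) ((p.1 != q.1 :> R) || (p.2 != q.2 :> R)).
Proof.
rewrite -negb_and; apply: (iffP negP) => pq.
  by move=> E; apply: pq; rewrite E !eqxx.
move=> /andP[/eqP h1 /eqP h2]; apply: pq.
by case: p h1 h2 => ? ? /=; case: q => ? ? /= -> ->.
Qed.

Lemma plane_eqP p q :
  reflect (p = q) ((p.1 == q.1 :> R) && (p.2 == q.2 :> R)).
Proof.
apply: (iffP andP) => [[/eqP h1 /eqP h2]|->]; last by split.
by case: p h1 h2 => ? ? /=; case: q => ? ? /= -> ->.
Qed.

Lemma edge_colorE p q : edge_color (p, q) = if red p q then Red else Blue.
Proof.
rewrite /edge_color /red /slope /=.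
have [->|pq] := eqVneq (p.1 : R) q.1; first by rewrite subrr mul0r ltxx.
rewrite /=; have d0 : q.1 - p.1 != 0 by rewrite subr_eq0 eq_sym.
have d2 : 0 < (q.1 - p.1) * (q.1 - p.1) by rewrite -expr2 exprn_even_gt0.
rewrite -(pmulr_lgt0 _ d2) mulrA divfK// mulrC //.
Qed.

Lemma same_edgeP p q r s :
  same_edge (p, q) (r, s) <-> (p = r /\ q = s) \/ (p = s /\ q = r).
Proof.
rewrite /same_edge /=; split; last first.
  by case=> -[-> ->] //; apply/seteqP; split => x /= [] ->; by [left|right].
move=> /seteqP[h1 h2].
have [e_pr|e_ps] : p = r \/ p = s by apply: h1; left.
  have [qr|qs] : q = r \/ q = s by apply: h1; right.
    have [sp|sq] : s = p \/ s = q by apply: h2; right.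
      by left; split; rewrite // sp e_pr.
    by left.
  by left.
have [qr|qs] : q = r \/ q = s by apply: h1; right.
  by right.
have [rp|rq] : r = p \/ r = q by apply: h2; left.
  by left; split.
by right.
Qed.

(** Quantifying over indices instead of points turns the event into a finite union. *)
Lemma has_monochromatic_crossingE (f : 'I_4 -> plane R) :
  has_monochromatic_crossing (range f) <->
  exists t : 'I_4 * 'I_4 * ('I_4 * 'I_4),
    monob (f t.1.1) (f t.1.2) (f t.2.1) (f t.2.2).
Proof.
split.
  move=> [[p q] [[r s] [[/= [i _ <-] [j _ <-] ij] [/= [k _ <-] [l _ <-] kl] [ns me] co]]].
  exists ((i, j), (k, l)); rewrite /monob /=; apply/and5P; split.
  - exact/plane_neqP.
  - exact/plane_neqP.
  - apply/negP => h; apply: ns; apply/same_edgeP.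
    case/orP: h => /and4P[/eqP h1 /eqP h2 /eqP h3 /eqP h4]; [left|right];
      by split; apply/plane_eqP; rewrite ?h1 ?h2 ?h3 ?h4 !eqxx.
  - exact/interior_meetE.
  - by move: co; rewrite !edge_colorE; case: ifP => _; case: ifP.
move=> [[[i j] [k l]]] /= /and5P[/plane_neqP ij /plane_neqP kl ns cr co].
exists (f i, f j), (f k, f l); split.
- by split => //=; [exists i|exists j].
- by split => //=; [exists k|exists l].
- split; last by apply/interior_meetE.
  move=> /same_edgeP h; move/negP: ns; apply.
  by case: h => -[-> ->]; rewrite !eqxx ?orbT.
- by rewrite !edge_colorE; move: co; case: (red _ _); case: (red _ _).
Qed.

Definition pt (z : coords (bool * 'I_4)%type R) i : plane R := (px z i, py z i).

Lemma measurable_crossing_event : measurable [set z : coords (bool * 'I_4)%type R |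
  has_monochromatic_crossing (range (pt z))].
Proof.
rewrite (_ : [set _ | _] = \bigcup_(t : 'I_4 * 'I_4 * ('I_4 * 'I_4))
    [set z | monob (pt z t.1.1) (pt z t.1.2) (pt z t.2.1) (pt z t.2.2)]).
  apply: fin_bigcup_measurable => // -[[i j] [k l]] _ /=.
  rewrite /monob /crossb /proper_cross /overlap /parallel /red /orient /dot /pt /=.
  by meas.
apply/seteqP; split => z /=.
  by move/has_monochromatic_crossingE => [t ht]; exists t.
by move=> [t _ ht]; apply/has_monochromatic_crossingE; exists t.
Qed.

Lemma orient_xx p q : (orient p q p = 0) * (orient p q q = 0) * (orient p p q = 0).
Proof. by rewrite /orient; do !split; ring. Qed.

(** If two edges overlapped on a line, general position would place both endpoints of one among
    those of the other, making them the same edge. Only proper crossings remain. *)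
Lemma generic_crossing (f : 'I_4 -> plane R) : injective f ->
  (forall i j k, i != j -> j != k -> i != k -> orient (f i) (f j) (f k) != 0) ->
  has_monochromatic_crossing (range f) <->
  exists i j k l, proper_cross (f i) (f j) (f k) (f l) &&
    (red (f i) (f j) == red (f k) (f l)).
Proof.
move=> injf gen; split.
  move=> /has_monochromatic_crossingE [[[i j] [k l]]] /=.
  move=> /and5P[/plane_neqP ij /plane_neqP kl ns cr co].
  exists i, j, k, l; apply/andP; split; last first.
    by move: co; case: (red _ _); case: (red _ _).
  case/orP: cr => // /and4P[/eqP par /eqP oi _ _].
  have oj : orient (f k) (f l) (f j) = 0.
    rewrite -oi; apply/eqP; rewrite -subr_eq0 -oppr_eq0 -[X in _ == X]par; apply/eqP.
    by rewrite /orient; ring.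
  have kl' : k != l by apply/eqP => E; apply: kl; rewrite E.
  have ij' : i != j by apply/eqP => E; apply: ij; rewrite E.
  have mem m : orient (f k) (f l) (f m) = 0 -> (m == k) || (m == l).
    move=> om; apply/negPn/negP; rewrite negb_or => /andP[mk ml].
    by have := gen k l m kl'; rewrite om eqxx eq_sym ml eq_sym mk => /(_ isT isT).
  move/negP: ns => []; move: ij'.
  case/orP: (mem _ oi) => /eqP ->; case/orP: (mem _ oj) => /eqP ->;
    by rewrite ?eqxx ?orbT.
move=> [i [j [k [l /andP[pc /eqP co]]]]].
apply/has_monochromatic_crossingE; exists ((i, j), (k, l)); rewrite /monob /=.
have pc' := pc; case/andP: pc' => h1 h2.
apply/and5P; split.
- by apply/plane_neqP => E; move: h2; rewrite E !orient_xx mul0r ltxx.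
- by apply/plane_neqP => E; move: h1; rewrite E !orient_xx mul0r ltxx.
- apply/negP => /orP[]/and4P[/eqP e1 /eqP e2 _ _]; move: h1.
    have -> : f i = f k by apply/plane_eqP; rewrite e1 e2 !eqxx.
    by rewrite !orient_xx mul0r ltxx.
  have -> : f i = f l by apply/plane_eqP; rewrite e1 e2 !eqxx.
  by rewrite !orient_xx mul0r ltxx.
- by rewrite /crossb pc.
- by rewrite co; case: (red _ _).
Qed.

End Quadruples.

(** * Reduction to the three pairings of four points *)

Section SortedQuadruples.
Context {R : realType}.
Implicit Types p q r s : plane R.

Definition same_color_cross p q r s : bool :=
  proper_cross p q r s && (red p q == red r s).

Lemma same_color_crossCl p q r s :
  same_color_cross q p r s = same_color_cross p q r s.
Proof.
rewrite /same_color_cross /proper_cross; congr (_ && _ && _).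
- by rewrite mulrC.
- by congr (_ < 0); rewrite /orient; ring.
- by congr (_ == _); rewrite /red; congr (0 < _); ring.
Qed.

Lemma same_color_crossC p q r s :
  same_color_cross r s p q = same_color_cross p q r s.
Proof. by rewrite /same_color_cross /proper_cross eq_sym [X in X && _]andbC. Qed.

Lemma same_color_crossCr p q r s :
  same_color_cross p q s r = same_color_cross p q r s.
Proof. by rewrite same_color_crossC same_color_crossCl same_color_crossC. Qed.

Lemma same_color_cross_shared p q r :
  (same_color_cross p p q r = false) * (same_color_cross p q p r = false).
Proof.
by rewrite /same_color_cross /proper_cross; split; rewrite !orient_xx mul0r ltxx ?andbF.
Qed.

(** Symmetry lets each edge have increasing indices and the first edge start lower. Edges with a
    common endpoint are excluded, as an orientation vanishes. *)
Lemma three_pairings (f : 'I_4 -> plane R) :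
  (exists i j k l, same_color_cross (f i) (f j) (f k) (f l)) <->
  [\/ same_color_cross (f i0) (f i1) (f i2) (f i3),
      same_color_cross (f i0) (f i2) (f i1) (f i3) |
      same_color_cross (f i0) (f i3) (f i1) (f i2)].
Proof.
split; last first.
  by case=> h; [exists i0, i1, i2, i3|exists i0, i2, i1, i3|exists i0, i3, i1, i2].
move=> [i [j [k [l]]]].
wlog ij : i j / (i < j)%N.
  move=> W; case: (ltngtP i j) => [||/val_inj ->]; first exact: W.
    by rewrite -same_color_crossCl; exact: W.
  by rewrite same_color_cross_shared.
wlog kl : k l / (k < l)%N.
  move=> W; case: (ltngtP k l) => [||/val_inj ->]; first exact: W.
    by rewrite -same_color_crossCr; exact: W.
  by rewrite same_color_crossC same_color_cross_shared.
wlog ik : i j k l ij kl / (i < k)%N.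
  move=> W; case: (ltngtP i k) => [||/val_inj ->]; first exact: W.
    by rewrite -same_color_crossC; exact: W.
  by rewrite same_color_cross_shared.
have [->|jk] := eqVneq j k.
  by rewrite same_color_crossCl same_color_cross_shared.
have [->|jl] := eqVneq j l.
  by rewrite same_color_crossCl same_color_crossCr same_color_cross_shared.
have -> : i = i0.
  by apply/val_inj => /=; move: i j k l ij kl ik jk jl =>
    [[|[|[|[|?]]]] //= ?] [[|[|[|[|?]]]] //= ?]
    [[|[|[|[|?]]]] //= ?] [[|[|[|[|?]]]] //= ?].
have : [|| [&& j == i1, k == i2 & l == i3], [&& j == i2, k == i1 & l == i3] |
    [&& j == i3, k == i1 & l == i2]].
  by move: i j k l ij kl ik jk jl =>
    [[|[|[|[|?]]]] //= ?] [[|[|[|[|?]]]] //= ?]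
    [[|[|[|[|?]]]] //= ?] [[|[|[|[|?]]]] //= ?].
case/or3P => /and3P[/eqP -> /eqP -> /eqP ->] h.
- by constructor 1.
- by constructor 2.
- by constructor 3.
Qed.

End SortedQuadruples.

(** * Crossings of four points sorted by abscissa *)

Section Sorted.
Context {R : realType}.
Variables (x : 'I_4 -> R) (x01 : x i0 < x i1) (x12 : x i1 < x i2) (x23 : x i2 < x i3).
Implicit Types y : 'I_4 -> R.

Let x02 : x i0 < x i2. Proof. exact: lt_trans x12. Qed.
Let x13 : x i1 < x i3. Proof. exact: lt_trans x23. Qed.
Let x03 : x i0 < x i3. Proof. exact: lt_trans x23. Qed.

(** With [orient3_123], this expresses the orientations of 012 and 123 through those of 013 and
    023. *)
Lemma orient3_012 y : orient3 x y i0 i1 i2 * (x i3 - x i0) =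
  (x i2 - x i0) * orient3 x y i0 i1 i3 - (x i1 - x i0) * orient3 x y i0 i2 i3.
Proof. by rewrite /orient3; ring. Qed.

Lemma orient3_123 y : orient3 x y i1 i2 i3 * (x i3 - x i0) =
  (x i3 - x i1) * orient3 x y i0 i2 i3 - (x i3 - x i2) * orient3 x y i0 i1 i3.
Proof. by rewrite /orient3; ring. Qed.

Definition pts y i : plane R := (x i, y i).

Lemma red_sorted y i j : x i < x j -> red (pts y i) (pts y j) = (y i < y j).
Proof. by move=> ij; rewrite /red /pts /= pmulr_rgt0 ?subr_gt0. Qed.

(** A vertical line separates the edges 01 and 23. Algebraically, the two sign conditions contradict
    the linear relations between the four orientations. *)
Lemma disjoint_pairing y :
  same_color_cross (pts y i0) (pts y i1) (pts y i2) (pts y i3) = false.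
Proof.
apply/negP => /andP[/andP[]].
have -> : orient (pts y i2) (pts y i3) (pts y i0) = orient3 x y i0 i2 i3.
  by rewrite /orient /orient3 /pts /=; ring.
have -> : orient (pts y i2) (pts y i3) (pts y i1) = orient3 x y i1 i2 i3.
  by rewrite /orient /orient3 /pts /=; ring.
have -> : orient (pts y i0) (pts y i1) (pts y i2) = orient3 x y i0 i1 i2 by [].
have -> : orient (pts y i0) (pts y i1) (pts y i3) = orient3 x y i0 i1 i3 by [].
have := orient3_012 y; have := orient3_123 y.
move: (orient3 x y i0 i1 i2) (orient3 x y i0 i1 i3).
move: (orient3 x y i0 i2 i3) (orient3 x y i1 i2 i3).
move: x01 x12 x23; rewrite -subr_gt0 -[x i1 < x i2]subr_gt0 -[x i2 < x i3]subr_gt0.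
have -> : x i3 - x i0 = (x i1 - x i0) + (x i2 - x i1) + (x i3 - x i2) by ring.
have -> : x i3 - x i1 = (x i2 - x i1) + (x i3 - x i2) by ring.
have -> : x i2 - x i0 = (x i1 - x i0) + (x i2 - x i1) by ring.
move: (x i1 - x i0) (x i2 - x i1) (x i3 - x i2) => a b c a0 b0 c0 F G D E r2 r1.
have s0 : 0 < a + b + c by rewrite !addr_gt0.
move=> FG DE _.
have [E0|E0|E0] := ltgtP E 0; last by rewrite E0 mulr0 ltxx in DE.
  have D0 : 0 < D by move: DE; rewrite nmulr_llt0.
  have FE : F < E.
    rewrite -(ltr_pM2l a0); have := mulr_gt0 D0 s0; rewrite r1.
    by have : b * E < 0 by [rewrite pmulr_rlt0]; lra.
  have G0 : 0 < G by move: FG; rewrite nmulr_rlt0//; exact: lt_trans E0.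
  have := mulr_gt0 G0 s0; rewrite r2.
  have : c * F < c * E by rewrite ltr_pM2l.
  have : b * F < 0 by rewrite pmulr_rlt0//; exact: lt_trans E0.
  by lra.
have D0 : D < 0 by move: DE; rewrite pmulr_llt0.
have FE : E < F.
  rewrite -(ltr_pM2l a0); have : D * (a + b + c) < 0 by rewrite pmulr_llt0.
  by rewrite r1; have : 0 < b * E by [rewrite mulr_gt0]; lra.
have F0 := lt_trans E0 FE.
have G0 : G < 0 by move: FG; rewrite pmulr_rlt0.
have : G * (a + b + c) < 0 by rewrite pmulr_llt0.
rewrite r2; have : c * E < c * F by rewrite ltr_pM2l.
have : 0 < b * F by rewrite mulr_gt0.
by lra.
Qed.

(** Crossing of 02 and 13, whose abscissa ranges interleave; [nest_cross] is for 03 and 12, whose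
    ranges are nested. *)
Definition shift_cross y : bool :=
  (0 < orient3 x y i0 i1 i2 * orient3 x y i0 i2 i3) &&
  (0 < orient3 x y i0 i1 i3 * orient3 x y i1 i2 i3).

Definition nest_cross y : bool :=
  (orient3 x y i0 i1 i3 * orient3 x y i0 i2 i3 < 0) &&
  (orient3 x y i0 i1 i2 * orient3 x y i1 i2 i3 < 0).

Lemma shift_crossE y :
  same_color_cross (pts y i0) (pts y i2) (pts y i1) (pts y i3) =
  shift_cross y && ((y i0 < y i2) == (y i1 < y i3)).
Proof.
rewrite /same_color_cross !red_sorted//; congr (_ && _).
rewrite /proper_cross andbC /shift_cross; congr (_ && _);
  rewrite -oppr_gt0; congr (0 < _); rewrite /orient /orient3 /pts /=; ring.
Qed.

Lemma nest_crossE y :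
  same_color_cross (pts y i0) (pts y i3) (pts y i1) (pts y i2) =
  nest_cross y && ((y i0 < y i3) == (y i1 < y i2)).
Proof.
rewrite /same_color_cross !red_sorted//; congr (_ && _).
rewrite /proper_cross andbC /nest_cross; congr (_ && _);
  congr (_ < 0); rewrite /orient /orient3 /pts /=; ring.
Qed.

Definition low_pair y : bool :=
  [&& y i0 < y i2, y i0 < y i3, y i1 < y i2 & y i1 < y i3].

Lemma orient3_lt0 y i j k : x i < x j -> x j < x k -> y i < y k -> y k <= y j ->
  orient3 x y i j k < 0.
Proof.
move=> ij jk yik ykj; rewrite /orient3 subr_lt0.
apply: (@lt_le_trans _ _ ((x k - x i) * (y k - y i))).
  by rewrite ltr_pM2r ?subr_gt0// ltrD2r.
by rewrite ler_pM2l ?subr_gt0 ?(lt_trans ij)// lerD2r.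
Qed.

Lemma orient3_gt0 y i j k : x i < x j -> x j < x k -> y j <= y i -> y j < y k ->
  0 < orient3 x y i j k.
Proof.
move=> ij jk yji yjk; rewrite /orient3.
have -> : (x j - x i) * (y k - y i) - (x k - x i) * (y j - y i) =
  (x j - x i) * (y k - y j) + (x k - x j) * (y i - y j) by ring.
by rewrite ltr_wpDr// ?mulr_gt0 ?mulr_ge0// ?subr_gt0 ?subr_ge0// ltW.
Qed.

Lemma orient3N y i j k : orient3 x (fun m => - y m) i j k = - orient3 x y i j k.
Proof. by rewrite /orient3; ring. Qed.

Lemma orient3_lt0' y i j k : x i < x j -> x j < x k -> y k <= y i -> y i < y j ->
  orient3 x y i j k < 0.
Proof.
move=> ij jk yki yij; rewrite /orient3 subr_lt0.
apply: (@le_lt_trans _ _ 0).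
  by rewrite mulr_ge0_le0// ?subr_ge0 ?subr_le0// ltW.
by rewrite mulr_gt0// subr_gt0// (lt_trans ij).
Qed.

(** Otherwise a horizontal line would separate the two rising edges. *)
Lemma shift_cross_low y : shift_cross y -> y i0 < y i2 -> y i1 < y i3 ->
  low_pair y.
Proof.
move=> /andP[h1 h2] y02 y13; rewrite /low_pair y02 y13 andbT /=.
apply/andP; split; rewrite ltNge; apply/negP => yy.
  have D0 : 0 < orient3 x y i0 i1 i2.
    apply: orient3_gt0 => //; first exact/ltW/(lt_le_trans y13).
    exact: lt_trans y13 (le_lt_trans yy y02).
  move: h1; rewrite pmulr_rgt0//; apply/negP; rewrite -leNgt ltW//.
  exact: orient3_lt0'.
have D0 : orient3 x y i0 i1 i2 < 0 by exact: orient3_lt0.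
have G0 : 0 < orient3 x y i1 i2 i3.
  by apply: orient3_gt0 => //; exact: le_lt_trans yy y13.
move: h1 h2; rewrite nmulr_rgt0// pmulr_lgt0// => F0 E0.
have := orient3_012 y.
have : orient3 x y i0 i1 i2 * (x i3 - x i0) < 0 by rewrite pmulr_llt0 ?subr_gt0.
have : 0 < (x i2 - x i0) * orient3 x y i0 i1 i3 by rewrite mulr_gt0// subr_gt0.
have : (x i1 - x i0) * orient3 x y i0 i2 i3 < 0 by rewrite pmulr_rlt0// subr_gt0.
by lra.
Qed.

Lemma nest_cross_low y : nest_cross y -> y i0 < y i3 -> y i1 < y i2 ->
  low_pair y.
Proof.
move=> /andP[h _] y03 y12; rewrite /low_pair y03 y12 /=.
apply/andP; split; rewrite ltNge; apply/negP => yy.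
  move: h; apply/negP; rewrite -leNgt ltW// mulr_gt0//.
    by apply: orient3_gt0 => //; [exact/ltW/(lt_le_trans y12)|
      exact: lt_trans y12 (le_lt_trans yy y03)].
  by apply: orient3_gt0 => //; exact: le_lt_trans yy y03.
move: h; apply/negP; rewrite -leNgt ltW// -mulrNN mulr_gt0// oppr_gt0.
  exact: orient3_lt0.
by apply: orient3_lt0 => //; exact/ltW/(le_lt_trans yy).
Qed.

(** Negating the ordinates flips every orientation, hence preserves crossings; as the ordinates are
    distinct, it exchanges the colors. The blue case thus reduces to the red one. *)
Lemma sorted_crossing y : injective y ->
  [\/ same_color_cross (pts y i0) (pts y i1) (pts y i2) (pts y i3),
      same_color_cross (pts y i0) (pts y i2) (pts y i1) (pts y i3) |
      same_color_cross (pts y i0) (pts y i3) (pts y i1) (pts y i2)] <->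
  low_pair y && convex_pos x y \/
  low_pair (fun i => - y i) && convex_pos x (fun i => - y i).
Proof.
move=> injy.
have shiftN : shift_cross (fun i => - y i) = shift_cross y.
  by rewrite /shift_cross !orient3N !mulrNN.
have nestN : nest_cross (fun i => - y i) = nest_cross y.
  by rewrite /nest_cross !orient3N !mulrNN.
have convE z : convex_pos x z = nest_cross z || shift_cross z by [].
have ltF i j : - y i < - y j -> (y i < y j) = false.
  by rewrite ltrN2 => /ltW h; rewrite ltNge h.
have ltN i j : i != j -> ~~ (y i < y j) = (- y i < - y j).
  by move=> ij; rewrite ltrN2 -leNgt lt_neqAle (inj_eq injy) eq_sym ij.
rewrite disjoint_pairing shift_crossE nest_crossE !convE shiftN nestN; split.
  case=> // /andP[sc].
    have [y02|y02] := boolP (y i0 < y i2) => [/eqP/esym y13|/eqP/esym/negbT].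
      by left; rewrite (shift_cross_low sc)// sc orbT.
    rewrite ltN// => y13; right; rewrite sc orbT andbT; apply: shift_cross_low => //.
      by rewrite shiftN.
    by rewrite -ltN.
  have [y03|y03] := boolP (y i0 < y i3) => [/eqP/esym y12|/eqP/esym/negbT].
    by left; rewrite (nest_cross_low sc)// sc.
  rewrite ltN// => y12; right; rewrite sc andbT; apply: nest_cross_low => //.
    by rewrite nestN.
  by rewrite -ltN.
case=> /andP[/and4P[h1 h2 h3 h4]] /orP[] sc.
- by constructor 3; rewrite sc h2 h3.
- by constructor 2; rewrite sc h1 h4.
- by constructor 3; rewrite sc (ltF _ _ h2) (ltF _ _ h3).
- by constructor 2; rewrite sc (ltF _ _ h1) (ltF _ _ h4).
Qed.

End Sorted.

(** * Sorting four distinct reals *)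

Section Sorting.
Context {R : realType}.
Implicit Types u : 'I_4 -> R.

Definition sorted4 u : bool := [&& u i0 < u i1, u i1 < u i2 & u i2 < u i3].

Lemma sorted4_homo u : sorted4 u -> forall i j : 'I_4, (i < j)%N -> u i < u j.
Proof.
move=> /and3P[h1 h2 h3].
have h13 := lt_trans h2 h3; have h02 := lt_trans h1 h2; have h03 := lt_trans h1 h13.
have E (i : 'I_4) : [|| i == i0, i == i1, i == i2 | i == i3].
  by case: i => [[|[|[|[|]]]]].
by move=> i j; case/or4P: (E i) => /eqP ->; case/or4P: (E j) => /eqP ->.
Qed.

Lemma homo_sorted4 u : (forall i j : 'I_4, (i < j)%N -> u i < u j) -> sorted4 u.
Proof. by move=> h; apply/and3P; split; apply: h. Qed.

Lemma sorted4_inj u : sorted4 u -> injective u.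
Proof.
move=> /sorted4_homo h i j; case: (ltngtP i j) => [/h|/h|/val_inj//].
  by move=> + E; rewrite E ltxx.
by move=> + E; rewrite E ltxx.
Qed.

(** Counting the smaller values gives the rank, a permutation whose inverse sorts. Uniqueness: four
    increasing ranks below 4 are 0, 1, 2, 3. *)
Lemma sorting_perm u : injective u ->
  exists! s : {perm 'I_4}, sorted4 (u \o s).
Proof.
move=> inju.
pose r i := #|[pred j | u j < u i]|.
have r_lt4 i : (r i < 4)%N.
  have : [pred j | u j < u i] \proper 'I_4.
    by apply/properP; split; [exact/fintype.subsetP|exists i; rewrite ?inE ?ltxx].
  by move/proper_card; rewrite card_ord.
have r_lt i j : u i < u j -> (r i < r j)%N.
  move=> ij; apply: proper_card; apply/properP; split.
    by apply/fintype.subsetP => k; rewrite !inE => /lt_trans; apply.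
  by exists i; rewrite !inE ?ltxx.
pose rk i := Ordinal (r_lt4 i).
have injr : injective rk.
  move=> i j /(congr1 val) /= rij; apply: inju; apply/eqP; rewrite eq_le !leNgt.
  by apply/andP; split; apply/negP => /r_lt; rewrite rij ltnn.
pose p := perm injr.
have sortE (s : {perm 'I_4}) : sorted4 (u \o s) -> s = (p^-1)%g.
  move=> /and3P[/= /r_lt h1 /r_lt h2 /r_lt h3].
  have pE i : p (s i) = i.
    apply/val_inj; rewrite permE /=.
    have := r_lt4 (s i3); have E : [|| i == i0, i == i1, i == i2 | i == i3].
      by case: i => [[|[|[|[|]]]]].
    move: h1 h2 h3; case/or4P: E => /eqP -> /=; lia.
  by apply/perm.permP => i; apply: (@perm_inj _ p); rewrite pE permKV.
exists (p^-1)%g; split; last by move=> s /sortE ->.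
apply: homo_sorted4 => i j ij /=; rewrite ltNge le_eqVlt; apply/negP => /orP[/eqP|].
  by move/inju/perm_inj => E; rewrite E ltnn in ij.
move/r_lt; have rE k : r ((p^-1)%g k) = k.
  by have := permKV p k; rewrite permE => /(congr1 val).
by rewrite !rE ltnNge ltnW.
Qed.

Lemma sorting_perm_unique u (s t : {perm 'I_4}) :
  sorted4 (u \o s) -> sorted4 (u \o t) -> s = t.
Proof.
move=> ss st; have inju : injective u.
  move=> i j ij; rewrite -[i](permKV s) -[j](permKV s); congr (s _).
  by apply: (sorted4_inj ss); rewrite /= !permKV.
by have [r [_ r_uniq]] := sorting_perm inju; rewrite -(r_uniq _ ss) -(r_uniq _ st).
Qed.

End Sorting.

(** * Summation over the orders of the coordinates *)

Section Assembly.
Context {R : realType}.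
Notation Z := (coords (bool * 'I_4)%type R).
Implicit Types z : Z.
Context (Q : probability Z R) (Qcube : uniform_cube Q).

Definition null (N : set Z) : Prop := measurable N /\ Q N = 0%E.

Lemma null_big (I : Type) (s : seq I) (P : pred I) (N : I -> set Z) :
  (forall i, P i -> null (N i)) -> null (\big[setU/set0]_(i <- s | P i) N i).
Proof.
move=> nN; apply: (big_ind null) => //.
by move=> A B nA nB; exact: nullU.
Qed.

Lemma prob_eq (A B N : set Z) : measurable A -> measurable B -> null N ->
  (forall z, ~ N z -> A z <-> B z) -> prob Q A = prob Q B.
Proof.
by move=> mA mB [mN N0] AB; rewrite /prob (measure_eq_outside_null mA mB mN N0 AB).
Qed.

Lemma prob_big (I : choiceType) (s : seq I) (F : I -> set Z) : uniq s ->
  (forall i, measurable (F i)) ->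
  (forall i j z, F i z -> F j z -> i = j) ->
  prob Q (\big[setU/set0]_(i <- s) F i) = \sum_(i <- s) prob Q (F i).
Proof.
move=> us mF dF; elim: s us => [_|i s IH /= /andP[is_ us]].
  by rewrite !big_nil /prob measure0.
have m s' : measurable (\big[setU/set0]_(j <- s') F j).
  by apply: big_ind => // ? ? ? ?; exact: measurableU.
rewrite !big_cons -IH//; apply: (@prob_split _ _ _ _ _ set0) => //.
  exact: measurableU.
move=> z Fi; rewrite -bigcup_seq => -[j js Fj].
by move: is_; rewrite (dF _ _ _ Fi Fj) js.
Qed.

Lemma in_big (I : finType) (P : pred I) (N : I -> set Z) i z :
  P i -> N i z -> (\big[setU/set0]_(i | P i) N i) z.
Proof. by move=> Pi Ni; rewrite (bigD1 i)//=; left. Qed.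

Definition tie (t : bool * 'I_4 * 'I_4) : set Z :=
  [set z | z (t.1.1, t.1.2) - z (t.1.1, t.2) == 0 :> R].

Definition ties : set Z := \big[setU/set0]_(t | t.1.2 != t.2) tie t.

Lemma null_ties : null ties.
Proof.
apply: null_big => -[[b i] j] /= ij.
have mN : measurable (tie (b, i, j)).
  apply: measurable_bool; apply: measurable_fun_eq => //.
  apply: measurable_fun_add; last apply: measurable_fun_opp.
    exact: (measurable_coord (b, i)).
  exact: (measurable_coord (b, j)).
split=> //; apply: (uniform_cube_null Qcube (i := (b, i))) => // z t u.
rewrite /tie /upd /= !xpair_eqE !eqxx /= [j == i]eq_sym (negbTE ij) => /eqP h1 /eqP h2.
by lra.
Qed.

Lemma ties_inj z : ~ ties z -> injective (px z) /\ injective (py z).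
Proof.
move=> nt; split => i j ij; apply/eqP/negP => /negP nij; apply: nt.
  by apply: (@in_big _ _ _ (true, i, j)) => //=; rewrite /tie /= subr_eq0; apply/eqP.
by apply: (@in_big _ _ _ (false, i, j)) => //=; rewrite /tie /= subr_eq0; apply/eqP.
Qed.

(** The first conjunct gives the ordinate of the middle point a nonzero coefficient in the
    orientation; the excluded case belongs to [ties]. *)
Definition collinear (t : 'I_4 * 'I_4 * 'I_4) : set Z :=
  [set z | (px z t.1.1 != px z t.2) &&
    (orient (pt z t.1.1) (pt z t.1.2) (pt z t.2) == 0)].

Definition degenerate : set Z := ties `|`
  \big[setU/set0]_(t | [&& t.1.1 != t.1.2, t.1.2 != t.2 & t.1.1 != t.2]) collinear t.

Lemma null_degenerate : null degenerate.
Proof.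
apply: nullU; first exact: null_ties.
apply: null_big => -[[i j] k] /= /and3P[ij jk ik].
have mN : measurable (collinear (i, j, k)).
  by rewrite /collinear /orient /pt /=; meas.
split=> //; apply: (uniform_cube_null Qcube (i := (false, j))) => // z t u.
rewrite /collinear /orient /pt; coordE.
rewrite !xpair_eqE /= !eqxx [k == j]eq_sym (negbTE ij) (negbTE jk).
rewrite -subr_eq0 => /andP[h /eqP h1] /andP[_ /eqP h2].
have : (z (true, k) - z (true, i)) * (t - u) = 0 :> R by lra.
move/eqP; rewrite mulf_eq0 => /orP[/eqP h3|]; last by rewrite subr_eq0 => /eqP.
by move/eqP: h => []; lra.
Qed.

Lemma degenerate_generic z : ~ degenerate z ->
  [/\ injective (px z), injective (py z) &
    forall i j k, i != j -> j != k -> i != k ->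
      orient (pt z i) (pt z j) (pt z k) != 0].
Proof.
move=> /not_orP[/ties_inj [ix iy] nc]; split => // i j k ij jk ik.
apply/negP => o0; apply: nc; apply: (@in_big _ _ _ (i, j, k)) => /=.
  by rewrite ij jk ik.
by rewrite /collinear /= (inj_eq ix) ik.
Qed.

Definition xsorted : set Z := [set z | sorted4 (px z)].

Lemma measurable_xsorted : measurable xsorted.
Proof. by rewrite /xsorted /sorted4; meas. Qed.

(** Up to ties, [A] splits by the permutation that sorts the abscissas into 24 pieces of equal
    probability. The action on ordinates is left open, to permute either whole points or abscissas
    alone. *)
Lemma prob_sort (g : {perm 'I_4} -> bool * 'I_4 -> bool * 'I_4) (A : set Z) :
  (forall s, injective (g s)) -> (forall s i, g s (true, i) = (true, s i)) ->
  measurable A -> (forall s z, A (relabel (g s) z) <-> A z) ->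
  prob Q A = 24 * prob Q (A `&` xsorted).
Proof.
move=> ginj gx mA gA.
pose F s : set Z := relabel (g s) @^-1` (A `&` xsorted).
have mAx : measurable (A `&` xsorted).
  by apply: measurableI => //; exact: measurable_xsorted.
have mF s : measurable (F s).
  rewrite -[F s]setTI; exact: (measurable_relabel (g s)).
have prF s : prob Q (F s) = prob Q (A `&` xsorted).
  by rewrite /prob (uniform_cube_relabel Qcube).
have Fx s z : F s z <-> A z /\ sorted4 (px z \o s).
  have sx : px (relabel (g s) z) = px z \o s.
    by apply/funext => i; rewrite /px /relabel gx.
  rewrite /F /= /xsorted /= sx; split=> -[Az sz]; first by split=> //; move/gA: Az.
  by split=> //; apply/(gA s z).
rewrite (@prob_eq _ (\big[setU/set0]_(s : {perm 'I_4}) F s) ties) //; last 3 first.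
- by apply: big_ind => // ? ? ? ?; exact: measurableU.
- exact: null_ties.
- move=> z /ties_inj [ix _]; split => [Az|].
    have [s [ss _]] := sorting_perm ix.
    by apply: (@in_big _ _ _ s) => //; apply/Fx.
  by rewrite -bigcup_seq => -[s _ /Fx[]].
rewrite prob_big ?index_enum_uniq//; last first.
  by move=> s t z /Fx[_ ss] /Fx[_ st]; exact: sorting_perm_unique ss st.
rewrite (eq_bigr (fun=> prob Q (A `&` xsorted))) => [|s _]; last exact: prF.
by rewrite sumr_const (_ : #|_| = 24%N) ?mulr_natl//; exact: (@card_Sn 4).
Qed.

Definition perm_xy (s : {perm 'I_4}) (p : bool * 'I_4) : bool * 'I_4 :=
  (p.1, s p.2).

Definition perm_x (s : {perm 'I_4}) (p : bool * 'I_4) : bool * 'I_4 :=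
  if p.1 then (true, s p.2) else p.

Lemma perm_xy_inj s : injective (perm_xy s).
Proof. by move=> [b i] [c j] [-> /perm_inj ->]. Qed.

Lemma perm_x_inj s : injective (perm_x s).
Proof. by move=> [[] i] [[] j] //= [/perm_inj ->]. Qed.

Definition ysorted : set Z := [set z | sorted4 (py z)].

Lemma measurable_ysorted : measurable ysorted.
Proof. by rewrite /ysorted /sorted4; meas. Qed.

Lemma prob_xsorted : 24 * prob Q xsorted = 1.
Proof.
have := @prob_sort perm_xy setT perm_xy_inj (fun _ _ => erefl) measurableT.
rewrite setTI => <- //; first by rewrite /prob probability_setT.
Qed.

Lemma prob_ysorted : prob Q ysorted = prob Q xsorted.
Proof.
pose g (p : bool * 'I_4) := (~~ p.1, p.2).
rewrite /prob -(uniform_cube_relabel Qcube (g := g)) //.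
  by move=> [b i] [c j] [/negb_inj -> ->].
exact: measurable_ysorted.
Qed.

Definition open_cube : set Z := box (fun=> `]0%R, 1%R[%classic).

Lemma null_outside : null (~` open_cube).
Proof.
have mc : measurable open_cube by apply: measurable_box => i; exact: measurable_itv.
split; first exact: measurableC.
by rewrite probability_setC// uniform_cube_itvoo// subee.
Qed.

Lemma open_cube_chain z : open_cube z ->
  (chain (px z) = sorted4 (px z)) * (chain (py z) = sorted4 (py z)) .
Proof.
move=> cz; have b p : (0 < z p) * (z p < 1).
  by have := cz p; rewrite /= in_itv /= => /andP[-> ->].
by rewrite /chain /sorted4 /px /py !b !andbT.
Qed.

(** Here [576 = 24 ^ 2]: abscissas and ordinates are sorted separately. *)
Lemma prob_cell : 576 * prob Q [set z | cell z] = 1.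
Proof.
have := @prob_sort perm_x ysorted perm_x_inj (fun _ _ => erefl) measurable_ysorted.
rewrite prob_ysorted => H.
rewrite (@prob_eq _ (ysorted `&` xsorted) _ _ _ null_outside).
- by have := H (fun _ _ => iff_refl _); have := prob_xsorted; lra.
- exact: measurable_bool (@measurable_cell R).
- by apply: measurableI; [exact: measurable_ysorted|exact: measurable_xsorted].
- move=> z /contrapT /open_cube_chain cE; rewrite /= /cell !cE.
  by split => [/andP[? ?]|[? ?]]; [split|apply/andP; split].
Qed.

(** The flags exchange the first two and the last two indices, giving the orders 1234, 1243, 2134,
    2143. *)
Definition swp (e f : bool) (i : 'I_4) : 'I_4 :=
  if e && (i == i0) then i1 else if e && (i == i1) then i0 else
  if f && (i == i2) then i3 else if f && (i == i3) then i2 else i.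

Lemma swpK e f : involutive (swp e f).
Proof. by case: e; case: f; case=> [[|[|[|[|]]]]]// ?; apply/val_inj. Qed.

Definition region e f : set Z := [set z |
  [&& chain (px z), chain (py z \o swp e f) & convex_pos (px z) (py z)]].

(** The region after relabelling the ordinates increasingly, which makes it a gap event. *)
Definition cell_region e f : set Z := [set z |
  cell z && convex_pos (px z) (py z \o swp e f)].

Lemma measurable_region e f : measurable (region e f).
Proof.
apply: measurable_bool; apply: measurable_and.
  by rewrite /chain; measfun.
apply: measurable_and.
  by rewrite /chain /=; measfun.
by rewrite /convex_pos /orient3; measfun.
Qed.

Lemma prob_region e f : prob Q (region e f) = prob Q (cell_region e f).
Proof.
pose g (p : bool * 'I_4) := if p.1 then p else (false, swp e f p.2).
rewrite /prob -(uniform_cube_relabel Qcube (g := g)); last exact: measurable_region.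
  congr (fine (Q _)); apply/seteqP.
  have xE z : px (relabel g z) = px z by [].
  have yE z : py (relabel g z) = py z \o swp e f by [].
  have yE' z : py z \o swp e f \o swp e f = py z.
    by apply/funext => i /=; rewrite swpK.
  by split => z; rewrite /region /cell_region /cell /= xE yE yE' andbA.
by move=> [[] i] [[] j] //= [/(inv_inj (swpK e f)) ->].
Qed.

Lemma cell_region_gap e f (G : R -> R -> R -> R -> R -> R -> bool) :
  (forall z, cell z -> convex_pos (px z) (py z \o swp e f) =
    G (px z i1 - px z i0) (px z i2 - px z i1) (px z i3 - px z i2)
      (py z i1 - py z i0) (py z i2 - py z i1) (py z i3 - py z i2)) ->
  cell_region e f = gap_event G.
Proof.
move=> H; apply/seteqP; split => z; rewrite /cell_region /gap_event /=;
  by move=> /andP[cz]; rewrite cz H.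
Qed.

Lemma prob_region_1234 : 3 * prob Q (region false false) = 2 * prob Q [set z | cell z].
Proof.
rewrite prob_region -(prob_cell_1234 Qcube); congr (_ * prob Q _).
apply: cell_region_gap => z /cell_gaps [[[a0 b0] c0] _].
exact: (convex_pos_1234 a0 b0 c0).
Qed.

Lemma prob_region_1243 : 3 * prob Q (region false true) = 2 * prob Q [set z | cell z].
Proof.
rewrite prob_region -(prob_cell_1243 Qcube); congr (_ * prob Q _).
apply: cell_region_gap => z /cell_gaps [[[a0 b0] c0] [[u0 v0] w0]].
exact: (convex_pos_1243 a0 b0 c0 u0 v0 w0).
Qed.

Lemma prob_region_2134 : 3 * prob Q (region true false) = 2 * prob Q [set z | cell z].
Proof.
rewrite prob_region -(prob_cell_2134 Qcube); congr (_ * prob Q _).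
apply: cell_region_gap => z /cell_gaps [[[a0 b0] c0] [[u0 v0] w0]].
exact: (convex_pos_2134 a0 b0 c0 u0 v0 w0).
Qed.

Lemma prob_region_2143 : prob Q (region true true) = prob Q [set z | cell z].
Proof.
rewrite prob_region; congr (prob Q _); apply/seteqP; split => z; rewrite /cell_region /=.
  by move=> /andP[].
move=> cz; rewrite cz /=; have [[[a0 b0] c0] [[u0 v0] w0]] := cell_gaps cz.
exact: (convex_pos_2143 a0 b0 c0 u0 v0 w0).
Qed.

Definition red_event : set Z := [set z |
  [&& sorted4 (px z), low_pair (py z) & convex_pos (px z) (py z)]].

Lemma measurable_red_event : measurable red_event.
Proof.
by rewrite /red_event /sorted4 /low_pair /convex_pos /orient3; meas.
Qed.

Lemma chainE (u : 'I_4 -> R) : (forall i, 0 < u i < 1) -> chain u = sorted4 u.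
Proof.
move=> u01; rewrite /chain /sorted4.
by have /andP[-> _] := u01 i0; have /andP[_ ->] := u01 i3; rewrite !andbT.
Qed.

Lemma red_event_region z : injective (py z) -> open_cube z ->
  red_event z <-> exists p, region p.1 p.2 z.
Proof.
move=> iy cz.
have b p : 0 < z p < 1 by have := cz p; rewrite /= in_itv.
have cE e f : chain (py z \o swp e f) = sorted4 (py z \o swp e f).
  by apply: chainE => i; exact: b.
have cx : chain (px z) = sorted4 (px z) by apply: chainE => i; exact: b.
have nlt i j : i != j -> ~~ (py z i < py z j) -> py z j < py z i.
  by move=> ij; rewrite -leNgt lt_neqAle (inj_eq iy) eq_sym ij.
rewrite /red_event /region /=; split.
  move=> /and3P[sx /and4P[h02 h03 h12 h13] cv].
  (* The flags record which of the two pairs is inverted. *)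
  exists (py z i1 < py z i0, py z i3 < py z i2) => /=.
  rewrite cx sx cv cE andbT /sorted4 /=.
  have [l10|/nlt-/(_ isT) l01] := boolP (py z i1 < py z i0);
    have [l32|/nlt-/(_ isT) l23] := boolP (py z i3 < py z i2);
    by rewrite /swp /=; apply/and3P.
move=> [[e f]] /= /and3P[]; rewrite cx cE => -> + ->; rewrite andbT /=.
move=> /sorted4_homo h; have {}h i j : (swp e f i < swp e f j)%N -> py z i < py z j.
  by move=> /h /=; rewrite !swpK.
by apply/and4P; split; apply: h; case: e; case: f.
Qed.

Lemma region_inj z p q : region p.1 p.2 z -> region q.1 q.2 z -> p = q.
Proof.
have H e f : region e f z -> (py z i1 < py z i0, py z i3 < py z i2) = (e, f).
  move=> /and3P[_ /and5P[_ /= h1 _ h2 _] _]; move: h1 h2.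
  by case: e; case: f; rewrite /swp /= => h1 h2;
    rewrite ?h1 ?h2 ?(lt_gtF h1) ?(lt_gtF h2).
by case: p => e f; case: q => e' f' /= /H <- /H <-.
Qed.

(** The four regions amount to [1 + 3 * (2 / 3) = 3] cells, and [3 / 576 = 1 / 192]. *)
Lemma prob_red_event : 192 * prob Q red_event = 1.
Proof.
have mB : measurable (\big[setU/set0]_(p : bool * bool) region p.1 p.2).
  by apply: big_ind => // [? ? ? ?|p _]; [exact: measurableU|exact: measurable_region].
rewrite (@prob_eq _ _ _ measurable_red_event mB (nullU null_ties null_outside)).
  rewrite prob_big ?index_enum_uniq//; last 2 first.
  - by move=> p; exact: measurable_region.
  - by move=> p q z; exact: region_inj.
  rewrite -(pair_bigA _ (fun e f => prob Q (region e f))) /= !big_bool /=.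
  have := prob_cell; have := prob_region_1234; have := prob_region_1243.
  by have := prob_region_2134; have := prob_region_2143; lra.
move=> z /not_orP[/ties_inj [_ iy] /contrapT cz].
rewrite red_event_region// -bigcup_seq; split => [[p rp]|[p _ rp]]; exists p => //=.
by rewrite mem_index_enum.
Qed.

Definition flip_y : Z -> Z := flip (fun p => ~~ p.1).

(** With the abscissas sorted, the event is up to a null set the disjoint union of [red_event] and
    its mirror image, so its probability is [24 * (2 / 192)]. *)
Lemma prob_crossing_event (E : set Z) :
  E = [set z | has_monochromatic_crossing (range (pt z))] -> Q E = (4^-1)%:E.
Proof.
move=> EE; have mE : measurable E by rewrite EE; exact: measurable_crossing_event.
rewrite probE//; congr EFin.
have prE24 : prob Q E = 24 * prob Q (E `&` xsorted).
  apply: (@prob_sort perm_xy) => // [s|s z]; first exact: perm_xy_inj.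
  rewrite EE /=.
  have -> // : range (pt (relabel (perm_xy s) z)) = range (pt z).
  apply/seteqP; split => _ /= [i _ <-]; first by exists (s i).
  by exists ((s^-1)%g i) => //; rewrite /pt /px /py /relabel /perm_xy /= permKV.
pose F' := flip_y @^-1` red_event.
have mF' : measurable F'.
  rewrite -[F']setTI; apply: measurable_flip => //; exact: measurable_red_event.
have prF' : prob Q F' = prob Q red_event.
  by rewrite /prob (uniform_cube_flip Qcube)//; exact: measurable_red_event.
have F'E z : F' z <-> [/\ sorted4 (px z), low_pair (fun i => - py z i) &
    convex_pos (px z) (fun i => - py z i)].
  (* [flip_y] yields [1 - y] where [sorted_crossing] has [- y]; comparisons and orientations depend
     on differences only. *)
  have -> : F' z = [&& sorted4 (px z), low_pair (fun i => 1 - py z i) &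
    convex_pos (px z) (fun i => 1 - py z i)] by [].
  rewrite /low_pair !ltrD2l.
  have -> : convex_pos (px z) (fun i => 1 - py z i) =
      convex_pos (px z) (fun i => - py z i).
    have dE i j k : orient3 (px z) (fun i => 1 - py z i) i j k =
      orient3 (px z) (fun i => - py z i) i j k by rewrite /orient3; ring.
    by rewrite /convex_pos !dE.
  by split => [/and3P[]|[-> -> ->]].
have [mN N0] := null_degenerate.
have H : prob Q (E `&` xsorted) = prob Q red_event + prob Q F'.
  apply: (@prob_split _ _ _ _ _ degenerate) => //.
  - exact: measurable_red_event.
  - by apply: measurableI => //; exact: measurable_xsorted.
  - move=> z /degenerate_generic [ix iy gen].
    have ipt : injective (pt z) by move=> i j [/ix].
    have sc := sorted_crossing.
    rewrite EE /= F'E; split.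
      move=> [hm sx]; have /and3P[x01 x12 x23] := sx.
      move: hm; rewrite (generic_crossing ipt gen) => /three_pairings.
      move/(sorted_crossing x01 x12 x23 iy) => [/andP[lp cv]|/andP[lp cv]].
        by left; apply/and3P.
      by right.
    case=> [/and3P[sx lp cv]|[sx lp cv]]; split => //; have /and3P[x01 x12 x23] := sx;
      apply/(generic_crossing ipt gen)/three_pairings/(sorted_crossing x01 x12 x23 iy).
      by left; rewrite lp cv.
    by right; rewrite lp cv.
  - move=> z /and3P[_ /and4P[h1 _ _ _] _] /F'E [_ /and4P[h2 _ _ _] _].
    by move: h2; rewrite ltrN2 (lt_gtF h1).
by rewrite prE24 H prF'; have := prob_red_event; clear; lra.
Qed.

End Assembly.

(** * Transfer from four random points to their eight coordinates *)

Theorem theorem1 (R : realType) (d : measure_display) (T : measurableType d)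
    (P : probability T R) (X : 'I_4 -> {RV P >-> plane R})
    (Xindep : mutually_independent X)
    (Xunif : forall i : 'I_4, uniform_on_unit_square (X i)) :
  P [set w | has_monochromatic_crossing (range (fun i : 'I_4 => X i w))] =
  (4^-1 : R)%:E.
Proof.
pose Z := coords (bool * 'I_4)%type R.
pose V w : Z := fun p => if p.1 then (X p.2 w).1 else (X p.2 w).2.
have mV : measurable_fun setT V.
  apply: measurable_fun_coords => -[[] i]; rewrite /V /=.
    exact: (measurableT_comp measurable_fst (measurable_funPT (X i))).
  exact: (measurableT_comp measurable_snd (measurable_funPT (X i))).
pose VM := isMeasurableFun.Build _ _ _ _ V mV.
pose VV : {mfun T >-> Z} := HB.pack V VM.
pose Q : probability Z R := distribution P VV.
have Qcube : uniform_cube Q.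
  move=> A mA; rewrite /Q /= /distribution /pushforward /=.
  (* A box in the eight coordinates is a product of four rectangles: independence factors it over
     the points, and uniformity splits each rectangle into its two sides. *)
  pose B i := A (true, i) `*` A (false, i).
  have mB i : measurable (B i) by exact: measurableX.
  have -> : V @^-1` box A = \bigcap_(i in [set` [set: 'I_4]%SET]) (X i @^-1` B i).
    apply/seteqP; split => w /=.
      by move=> h i _; split; [exact: (h (true, i))|exact: (h (false, i))].
    by move=> h [[] i]; have [] := h i (finset.in_setT i).
  rewrite Xindep//.
  have XB i : P (X i @^-1` B i) =
      (lebesgue_measure (A (true, i) `&` `[0%R, 1%R]) *
       lebesgue_measure (A (false, i) `&` `[0%R, 1%R]))%E.
    have := Xunif i (B i) (mB i); rewrite /distribution /pushforward => ->.
    rewrite /B /unit_square -setXI product_measure1E//;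
      by apply: measurableI => //; exact: measurable_itv.
  rewrite (eq_bigr _ (fun i _ => XB i)) big_split /=.
  rewrite [RHS](eq_bigr (fun p => lebesgue_measure (A (p.1, p.2) `&` `[0%R, 1%R])));
    last by move=> [].
  rewrite -(pair_bigA _ (fun b i => lebesgue_measure (A (b, i) `&` `[0%R, 1%R]))) /=.
  rewrite big_bool /=; congr (_ * _)%E; apply: eq_bigl => i; exact: finset.in_setT.
rewrite -(prob_crossing_event Qcube erefl) /Q /distribution /pushforward /=.
congr (P _); apply/funext => w /=.
have -> // : pt (V w) = fun i => X i w.
by apply/funext => i; rewrite /pt /px /py /V /= -surjective_pairing.
Qed.
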